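(* The following two statements are equivalent. (A) For every cubic graph $G$ and every perfect matching $\mathcal M$ of $G$ such that $G/\mathcal M$ is $4$-connected, $G$ contains a cycle which dominates $\mathcal M$. (DCC) Every cyclically $4$-edge connected cubic graph has a dominating cycle.
   Context: All graphs are finite and loopless (multiple edges are allowed). Cubic means $3$-regular. A graph $G$ is $k$-connected if $|V(G)|>k$ and $G-X$ is connected for every $X\subseteq V(G)$ with $|X|<k$. A cycle dominates a matching $\mathcal M$ of a graph $G$ if the cycle contains at least one endvertex of each edge of $\mathcal M$. $G/\mathcal M$ denotes the graph which results from $G$ by contracting each edge of $\mathcal M$ to a distinct vertex. A dominating cycle of a graph $G$ is a cycle of $G$ which contains at least one endvertex of every edge of $G$. An edge cut of a connected graph $G$ is a set $E'\subseteq E(G)$ such that $G-E'$ is disconnected; it is a cyclic edge cut if at least two components of $G-E'$ are not trees. If $G$ contains two vertex-disjoint cycles, $\lambda_c(G)$ denotes the minimum size of a cyclic edge cut of $G$. A connected cubic graph $G$ is cyclically $4$-edge connected if $\lambda_c(G)\ge 4$. *)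

(* Defs.v *)
From HB Require Import structures.
From mathcomp Require Import all_boot.

Set Implicit Arguments.
Unset Strict Implicit.
Unset Printing Implicit Defensive.

(* Finite loopless multigraphs: an edge has exactly two endvertices, and
   distinct edges may have the same endvertices. *)
Record mgraph := MGraph {
  vertex : finType;
  edge : finType;
  ends : edge -> {set vertex};
  card_ends : forall e, #|ends e| == 2 }.

Record subgraph (G : mgraph) := Subgraph {
  verts : {set vertex G};
  edges : {set edge G};
  ends_verts : [forall e in edges, ends e \subset verts] }.

Definition subgraph_le (G : mgraph) (K H : subgraph G) : bool :=
  (verts K \subset verts H) && (edges K \subset edges H).

Lemma del_verts_proof (G : mgraph) (X : {set vertex G}) :
  [forall e in [set e : edge G | ends e \subset ~: X], ends e \subset ~: X].
Proof. by apply/forall_inP => e; rewrite inE. Qed.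

Definition del_verts (G : mgraph) (X : {set vertex G}) : subgraph G :=
  Subgraph (del_verts_proof X).

Lemma spanning_proof (G : mgraph) (F : {set edge G}) :
  [forall e in F, ends e \subset [set: vertex G]].
Proof. by apply/forall_inP => e _; exact: subsetT. Qed.

Definition spanning (G : mgraph) (F : {set edge G}) : subgraph G :=
  Subgraph (spanning_proof F).

Definition del_edges (G : mgraph) (F : {set edge G}) : subgraph G :=
  spanning (~: F).

Definition whole (G : mgraph) : subgraph G := spanning [set: edge G].

Definition adj (G : mgraph) (H : subgraph G) : rel (vertex G) :=
  fun x y => [exists e in edges H, ends e == [set x; y]].

(* The graph without vertices is not connected. *)
Definition connected (G : mgraph) (H : subgraph G) : bool :=
  (verts H != set0) &&
  [forall x in verts H, forall y in verts H, connect (adj H) x y].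

Definition degree (G : mgraph) (H : subgraph G) (v : vertex G) : nat :=
  #|[set e in edges H | v \in ends e]|.

Definition regular (G : mgraph) (d : nat) (H : subgraph G) : bool :=
  [forall v in verts H, degree H v == d].

Definition cubic (G : mgraph) : bool := regular 3 (whole G).

Definition k_connected (k : nat) (G : mgraph) : Prop :=
  k < #|vertex G| /\
  forall X : {set vertex G}, #|X| < k -> connected (del_verts X).

(* Two parallel edges form a cycle. *)
Definition is_cycle (G : mgraph) (C : subgraph G) : bool :=
  connected C && regular 2 C.

Definition is_tree (G : mgraph) (K : subgraph G) : Prop :=
  connected K /\
  forall C : subgraph G, subgraph_le C K -> ~~ is_cycle C.

Definition is_component (G : mgraph) (H K : subgraph G) : Prop :=
  [/\ subgraph_le K H, connected K &
      forall L : subgraph G, subgraph_le K L -> subgraph_le L H ->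
        connected L -> subgraph_le L K].

Definition edge_cut (G : mgraph) (F : {set edge G}) : bool :=
  ~~ connected (del_edges F).

Definition cyclic_edge_cut (G : mgraph) (F : {set edge G}) : Prop :=
  edge_cut F /\
  exists K1 K2 : subgraph G,
    [/\ is_component (del_edges F) K1, is_component (del_edges F) K2,
        K1 <> K2, ~ is_tree K1 & ~ is_tree K2].

Definition two_disjoint_cycles (G : mgraph) : Prop :=
  exists C1 C2 : subgraph G,
    [/\ is_cycle C1, is_cycle C2 & [disjoint verts C1 & verts C2]].

(* The cyclic edge connectivity of G is defined, and equal to k. *)
Definition is_lambda_c (G : mgraph) (k : nat) : Prop :=
  [/\ two_disjoint_cycles G,
      exists2 F : {set edge G}, cyclic_edge_cut F & #|F| = k &
      forall F : {set edge G}, cyclic_edge_cut F -> k <= #|F|].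

Definition cyclically_4_edge_connected (G : mgraph) : Prop :=
  [/\ connected (whole G), cubic G &
      exists2 k, is_lambda_c G k & 4 <= k].

Definition matching (G : mgraph) (M : {set edge G}) : bool :=
  [forall e in M, forall f in M, (e != f) ==> [disjoint ends e & ends f]].

Definition perfect_matching (G : mgraph) (M : {set edge G}) : bool :=
  matching M && [forall v : vertex G, exists e in M, v \in ends e].

Section Contraction.
Variables (G : mgraph) (M : {set edge G}).

(* The vertices identified with v: those joined to v by a path in M. *)
Definition contract_class (v : vertex G) : {set vertex G} :=
  [set w | connect (adj (spanning M)) v w].

Definition contract_vertex : finType :=
  {B : {set vertex G} | B \in codom contract_class}.

Definition contract_proj (v : vertex G) : contract_vertex :=
  exist _ (contract_class v) (codom_f contract_class v).

(* Graphs being loopless, an edge whose ends are identified disappears; this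
   concerns the edges of M and the edges parallel to them. *)
Definition contract_edge : finType :=
  {e : edge G | #|contract_proj @: ends e| == 2}.

Definition contract_ends (e : contract_edge) : {set contract_vertex} :=
  contract_proj @: ends (val e).

Definition contract : mgraph :=
  @MGraph contract_vertex contract_edge contract_ends (fun e => valP e).

End Contraction.

Definition dominates (G : mgraph) (C : subgraph G) (F : {set edge G}) : Prop :=
  forall e, e \in F -> exists2 v, v \in ends e & v \in verts C.

Definition dominating_cycle (G : mgraph) (C : subgraph G) : Prop :=
  is_cycle C /\ dominates C [set: edge G].

(* Main.v *)
(* From matchings to dominating cycles: inflate every vertex of a cyclically
   4-edge connected cubic graph [G] to a triangle.  The old edges form a perfect
   matching of the inflation, and contracting it gives the line graph of [G].
   If at most three edges separate the line graph, the endvertices of one side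
   form a set [A] with at most three boundary edges and at least two vertices on
   each side; counting degrees, both sides induce at least as many edges as
   vertices, hence contain cycles, which is impossible.  A cycle dominating the
   matching then shrinks to a dominating cycle of [G].

   Conversely, let [M] be a perfect matching of the cubic graph [G] with [G/M]
   4-connected.  Taking one end of each edge of a cut of size at most three gives
   a vertex separator of [G/M], and it follows that the cut either isolates a
   vertex or cuts off a triangle whose three vertices are matched to the outside.
   These triangles are disjoint, and contracting them gives a cubic graph [G']
   all of whose cuts of size at most three isolate a vertex.  A dominating cycle
   of [G'] lifts to [G] by running through all three vertices of each triangle
   it meets; as no matching edge lies in a triangle, the lift dominates [M].
   If [G'] has no two disjoint cycles, the dominating cycle is found by hand: a
   smallest vertex set inducing as many edges as vertices has at most four
   elements, which leaves at most six vertices. *)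

Require Import Defs.
From HB Require Import structures.
From mathcomp Require Import all_boot.
From mathcomp Require Import zify.
From Stdlib Require Import Classical.

Set Implicit Arguments.
Unset Strict Implicit.
Unset Printing Implicit Defensive.

(** * Reachability and counting preliminaries *)

Lemma connect_inv (T : finType) (r : rel T) (P : T -> Prop) x y :
  (forall u v, P u -> r u v -> P v) -> P x -> connect r x y -> P y.
Proof.
move=> rP Px /connectP[p]; elim: p x Px => [|z p IH] x Px /= => [_ ->//|].
by case/andP=> /rP-/(_ Px) Pz /IH; apply.
Qed.

Lemma card_mem_sum (T : finType) (A B : {set T}) : \sum_(v in A) (v \in B) = #|B :&: A|.
Proof.
rewrite -sum1_card [RHS](eq_bigl (fun v => (v \in A) && (v \in B))); last first.
  by move=> v; rewrite inE andbC.
by rewrite big_mkcondr.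
Qed.

Lemma card_setI_sum (T : finType) (A : {set T}) (P : pred T) :
  #|[set x in A | P x]| = \sum_(x in A) P x.
Proof.
rewrite -sum1_card (eq_bigl (fun x => (x \in A) && P x)); last by move=> x; rewrite inE.
by rewrite big_mkcondr.
Qed.

(** * Adjacency, components and degree sums in subgraphs *)

Section Subgraphs.
Variable G : mgraph.
Implicit Types (e : edge G) (x y v : vertex G) (A : {set vertex G})
  (F : {set edge G}) (K H C : subgraph G).

Lemma subgraph_eq K H : verts K = verts H -> edges K = edges H -> K = H.
Proof.
case: K H => [vK eK pK] [vH eH pH] /= e1 e2; subst.
by rewrite (bool_irrelevance pK pH).
Qed.

Lemma subgraph_le_anti K H : subgraph_le K H -> subgraph_le H K -> K = H.
Proof.
case/andP=> v1 e1 /andP[v2 e2].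
by apply: subgraph_eq; apply/eqP; rewrite eqEsubset ?v1 ?v2 ?e1 ?e2.
Qed.

Lemma edge_verts K e : e \in edges K -> ends e \subset verts K.
Proof. by move: (ends_verts K) => /forall_inP; apply. Qed.

Lemma edge_vert K e x : e \in edges K -> x \in ends e -> x \in verts K.
Proof. by move=> /edge_verts/subsetP; apply. Qed.

Lemma card_endsE e : #|ends e| = 2. Proof. exact/eqP/card_ends. Qed.

Lemma endsP e : exists x y, x != y /\ ends e = [set x; y].
Proof. by have /cards2P[x [y [xy ->]]] := card_ends e; exists x, y. Qed.

Lemma ends_pair e x y : x \in ends e -> y \in ends e -> x != y ->
  ends e = [set x; y].
Proof.
move=> xe ye xy; apply/eqP; rewrite eq_sym eqEcard card_endsE cards2 xy andbT.
by apply/subsetP=> z; rewrite !inE => /orP[]/eqP->.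
Qed.

Lemma ends_other e x : x \in ends e -> exists2 y, y != x & ends e = [set x; y].
Proof.
have [a [b [ab ->]]] := endsP e; rewrite !inE => /orP[]/eqP->.
  by exists b; rewrite // eq_sym.
by exists a; rewrite // setUC.
Qed.

Lemma adjP K x y :
  reflect (exists2 e, e \in edges K & ends e = [set x; y]) (adj K x y).
Proof.
apply: (iffP exists_inP) => -[e eK E]; exists e => //; exact/eqP.
Qed.

Lemma adj_sym K : symmetric (adj K).
Proof. by move=> x y; apply/adjP/adjP => -[e eK]; rewrite setUC; exists e. Qed.

Lemma adj_verts K x y : adj K x y -> (x \in verts K) /\ (y \in verts K).
Proof.
by case/adjP=> e eK E; split; apply: (edge_vert eK); rewrite E !inE eqxx ?orbT.
Qed.

Lemma edge_adj K e x y : e \in edges K -> x \in ends e -> y \in ends e ->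
  x != y -> adj K x y.
Proof. by move=> eK xe ye xy; apply/adjP; exists e => //; exact: ends_pair. Qed.

Lemma connect_adj_sym K : connect_sym (adj K).
Proof. exact/sym_connect_sym/adj_sym. Qed.

Lemma edge_connect K e x y : e \in edges K -> x \in ends e -> y \in ends e ->
  connect (adj K) x y.
Proof.
move=> eK xe ye; have [->|xy] := eqVneq x y; first exact: connect0.
exact/connect1/(edge_adj eK).
Qed.

(** Reachability cannot leave a closed set. Together with the converse [closed_connected], this lets
    connectedness be handled through closed vertex sets instead of paths. *)
Lemma connected_closed K A : connected K -> A \subset verts K -> A != set0 ->
  (forall x y, x \in A -> adj K x y -> y \in A) -> A = verts K.
Proof.
case/andP=> _ /forall_inP cK AK /set0Pn[x xA] clA; apply/eqP.
rewrite eqEsubset AK; apply/subsetP=> y yK.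
have /forall_inP/(_ y yK) := cK x (subsetP AK x xA).
by apply: (@connect_inv _ _ (fun z => z \in A)) xA => u v; exact: clA.
Qed.

Lemma closed_connected K : verts K != set0 ->
  (forall A, A \subset verts K -> A != set0 ->
   (forall x y, x \in A -> adj K x y -> y \in A) -> A = verts K) ->
  connected K.
Proof.
move=> K0 cl; rewrite /connected K0; apply/forall_inP=> x xK; apply/forall_inP=> y.
rewrite -(cl ([set z in verts K | connect (adj K) x z])).
- by rewrite inE => /andP[].
- by apply/subsetP=> z; rewrite inE => /andP[].
- by apply/set0Pn; exists x; rewrite inE xK connect0.
move=> u v; rewrite !inE => /andP[_ xu] uv; rewrite (adj_verts uv).2.
exact/(connect_trans xu)/connect1.
Qed.

Lemma sub_adj K H : edges K \subset edges H -> subrel (adj K) (adj H).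
Proof.
move=> KH x y /adjP[e eK E]; apply/adjP; exists e => //; exact: (subsetP KH).
Qed.

Lemma sub_connect_adj K H : edges K \subset edges H ->
  subrel (connect (adj K)) (connect (adj H)).
Proof. by move=> KH; apply: connect_sub => x y /(sub_adj KH)/connect1. Qed.

Lemma component_proof H x :
  [forall e in [set e in edges H | ends e \subset [set y in verts H | connect (adj H) x y]],
     ends e \subset [set y in verts H | connect (adj H) x y]].
Proof. by apply/forall_inP=> e; rewrite inE => /andP[]. Qed.

Definition component H x : subgraph G := Subgraph (component_proof H x).

Lemma component_le H x : subgraph_le (component H x) H.
Proof. by apply/andP; split; apply/subsetP=> z; rewrite inE => /andP[]. Qed.

Lemma mem_component H x : x \in verts H -> x \in verts (component H x).
Proof. by move=> xH; rewrite inE xH connect0. Qed.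

Lemma component_edge H x y e : y \in verts (component H x) -> e \in edges H -> y \in ends e ->
  e \in edges (component H x).
Proof.
rewrite !inE => /andP[_ xy] eH ye; rewrite eH /=; apply/subsetP=> z ze.
rewrite inE (edge_vert eH ze) /=; exact/(connect_trans xy)/(edge_connect eH).
Qed.

Lemma component_connected H x : x \in verts H -> connected (component H x).
Proof.
move=> xH; have xc := mem_component xH.
have cx y : y \in verts (component H x) -> connect (adj (component H x)) x y.
  rewrite inE => /andP[_ xy].
  suff [] : y \in verts (component H x) /\ connect (adj (component H x)) x y by [].
  move: xy; apply: (@connect_inv _ _ (fun y => y \in verts (component H x) /\
    connect (adj (component H x)) x y)); last by rewrite connect0.
  move=> u v [uc xu] /adjP[e eH E].
  have ue : u \in ends e by rewrite E !inE eqxx.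
  have ve : v \in ends e by rewrite E !inE eqxx orbT.
  have ec := component_edge uc eH ue.
  split; first exact: edge_vert ec ve.
  exact/(connect_trans xu)/(edge_connect ec).
apply/andP; split; first by apply/set0Pn; exists x.
apply/forall_inP=> y yc; apply/forall_inP=> z zc.
by apply: (@connect_trans _ _ x); [rewrite connect_adj_sym|]; apply: cx.
Qed.

Lemma le_component H K x : subgraph_le K H -> connected K -> x \in verts K ->
  subgraph_le K (component H x).
Proof.
case/andP=> vKH eKH /andP[_ /forall_inP cK] xK.
have sv : verts K \subset verts (component H x).
  apply/subsetP=> y yK; rewrite inE (subsetP vKH) //=.
  by have /forall_inP/(_ y yK) := cK x xK; exact: sub_connect_adj.
apply/andP; split=> //; apply/subsetP=> e eK; rewrite inE (subsetP eKH) //=.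
exact: subset_trans (edge_verts eK) sv.
Qed.

Lemma component_is_component H x : x \in verts H -> is_component H (component H x).
Proof.
move=> xH; split; [exact: component_le|exact: component_connected|].
move=> L /andP[/subsetP vL _] LH cL; apply: le_component => //.
exact/vL/mem_component.
Qed.

Lemma component_unique H K x : is_component H K -> x \in verts K -> K = component H x.
Proof.
case=> KH cK maxK xK; have le := le_component KH cK xK.
have xH : x \in verts H by case/andP: KH => /subsetP + _; apply.
apply: subgraph_le_anti => //; apply: maxK => //; first exact: component_le.
exact: component_connected.
Qed.

Lemma degree_gt0 K e v : e \in edges K -> v \in ends e -> 0 < degree K v.
Proof. by move=> eK ve; apply/card_gt0P; exists e; rewrite inE eK. Qed.

Lemma degree_edge K v : 0 < degree K v -> exists2 e, e \in edges K & v \in ends e.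
Proof. by case/card_gt0P=> e; rewrite inE => /andP[]; exists e. Qed.

Lemma component_degree H x v : v \in verts (component H x) -> degree (component H x) v = degree H v.
Proof.
move=> vc; apply: eq_card => e; rewrite [LHS]inE [RHS]inE.
apply/andP/andP=> -[eH ve]; split=> //; last exact: component_edge vc eH ve.
by move: eH; rewrite inE => /andP[].
Qed.

Lemma component_cycle H x : x \in verts H -> regular 2 H -> is_cycle (component H x).
Proof.
move=> xH /forall_inP rH; rewrite /is_cycle component_connected //=.
apply/forall_inP=> v vc; rewrite component_degree //; apply: rH.
by move: vc; rewrite inE => /andP[].
Qed.

Definition inner K A : {set edge G} := [set e in edges K | ends e \subset A].
Definition boundary K A : {set edge G} := [set e in edges K | #|ends e :&: A| == 1].

(** Double counting of incidences: an edge inside [A] is counted twice, an edge crossing its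
    boundary once, any other not at all. *)
Lemma handshake K A :
  \sum_(v in A) degree K v = (#|inner K A|).*2 + #|boundary K A|.
Proof.
have -> : \sum_(v in A) degree K v = \sum_(e in edges K) #|ends e :&: A|.
  rewrite (eq_bigr (fun v => \sum_(e in edges K) (v \in ends e))); last first.
    by move=> v _; rewrite /degree card_setI_sum.
  rewrite exchange_big /=; apply: eq_bigr => e _; exact: card_mem_sum.
rewrite /inner /boundary !card_setI_sum -mul2n big_distrr -big_split /=.
apply: eq_bigr => e _; case: (boolP (ends e \subset A)) => sA.
  by rewrite (setIidPl sA) card_endsE.
have := subset_leq_card (subsetIl (ends e) A); rewrite card_endsE.
have : #|ends e :&: A| != 2.
  apply: contraNN sA => /eqP c2; apply/setIidPl/eqP.
  by rewrite eqEcard subsetIl c2 card_endsE.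
by case: #|_| => [|[|[|]]].
Qed.

Lemma boundaryP K A e : reflect
  (e \in edges K /\ exists x y, [/\ x \in A, y \notin A & ends e = [set x; y]])
  (e \in boundary K A).
Proof.
rewrite inE; apply: (iffP andP) => -[eK]; last first.
  case=> x [y [xA yA E]]; split=> //; apply/cards1P; exists x; rewrite E.
  apply/setP=> z; rewrite !inE andb_orl; have [->|] := eqVneq z x; first by rewrite xA.
  by move=> _ /=; have [->|//] := eqVneq z y; rewrite (negPf yA).
move=> c1; split=> //; have [a [b [ab E]]] := endsP e.
have mA x : (x \in ends e :&: A) = (x \in [set a; b]) && (x \in A) by rewrite inE E.
have [aA|aA] := boolP (a \in A); have [bA|bA] := boolP (b \in A).
- suff : 1 < #|ends e :&: A| by case: #|_| c1 => [|[|]].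
  by apply/card_gt1P; exists a, b; rewrite !mA !inE !eqxx aA bA orbT.
- by exists a, b.
- by exists b, a; rewrite setUC.
have : #|ends e :&: A| = 0.
  apply/eqP; rewrite cards_eq0 -subset0; apply/subsetP=> x; rewrite mA !inE.
  by case/andP=> /orP[]/eqP->; rewrite (negPf aA, negPf bA).
by move=> c0; rewrite c0 in c1.
Qed.

Lemma boundaryC K A : boundary K (~: A) = boundary K A.
Proof.
apply/setP=> e; apply/boundaryP/boundaryP => -[eK [x [y [xA yA E]]]];
  split=> //; exists y, x; rewrite setUC; move: xA yA; rewrite !inE ?negbK.
  by move=> -> ->.
by move=> -> ->.
Qed.

End Subgraphs.

(** * Cycles and cyclic edge cuts *)

Section Cycles.
Variable G : mgraph.
Implicit Types (e : edge G) (x y v : vertex G) (A : {set vertex G})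
  (F : {set edge G}) (K H C : subgraph G).

Lemma restrict_proof K A : [forall e in inner K A, ends e \subset A].
Proof. by apply/forall_inP=> e; rewrite inE => /andP[]. Qed.

Definition restrict K A : subgraph G := Subgraph (restrict_proof K A).

Lemma restrict_le K A : A \subset verts K -> subgraph_le (restrict K A) K.
Proof. by move=> AK; rewrite /subgraph_le AK; apply/subsetP=> e; rewrite inE => /andP[]. Qed.

Lemma subgraph_le_trans K H L : subgraph_le K H -> subgraph_le H L -> subgraph_le K L.
Proof.
by case/andP=> v1 e1 /andP[v2 e2]; rewrite /subgraph_le (subset_trans v1 v2) (subset_trans e1 e2).
Qed.

Lemma inner_verts K : inner K (verts K) = edges K.
Proof.
apply/setP=> e; rewrite inE; apply: andb_idr; exact: edge_verts.
Qed.

Lemma boundary_verts K : boundary K (verts K) = set0.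
Proof.
apply/setP=> e; rewrite [RHS]inE; apply/negP; case/boundaryP=> eK [x [y [xK yK E]]].
by rewrite (edge_vert eK) // E !inE eqxx orbT in yK.
Qed.

Lemma inner_del K A v : v \in A ->
  #|inner K A| = #|inner K (A :\ v)| + degree (restrict K A) v.
Proof.
move=> vA; rewrite -(cardsID [set e | v \in ends e]) addnC; congr (_ + _).
  by apply: eq_card => e; rewrite !inE subsetD1 andbC -andbA.
by apply: eq_card => e; rewrite !inE.
Qed.

Lemma degree_restrict K A v : degree (restrict K A) v <= degree K v.
Proof.
by apply/subset_leq_card/subsetP=> e; rewrite !inE => /andP[/andP[-> _] ->].
Qed.

Lemma inner1 K v : inner K [set v] = set0.
Proof.
apply/setP=> e; rewrite !inE; apply/negP; case/andP=> _ /subset_leq_card.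
by rewrite card_endsE cards1.
Qed.

(** Induction on vertices plus edges. A surplus edge can be deleted. With equally many of both, the
    average degree is 2: either [K] is 2-regular and any component is a cycle, or some vertex of
    degree at most 1 can be deleted. *)
Lemma exists_cycle K : 0 < #|verts K| <= #|edges K| ->
  exists2 C, is_cycle C & subgraph_le C K.
Proof.
have [n] := ubnP (#|verts K| + #|edges K|); elim: n K => // n IH K.
rewrite ltnS => lt_n /andP[vK veK].
have [v_lt|e_le] := ltnP #|verts K| #|edges K|.
  have [e eK] : exists e, e \in edges K by apply/card_gt0P; lia.
  have dp : [forall f in edges K :\ e, ends f \subset verts K].
    by apply/forall_inP=> f; rewrite inE => /andP[_]; exact: edge_verts.
  have := cardsD1 e (edges K); rewrite eK => ce.
  have [||C cC leC] := IH (Subgraph dp); rewrite /=; try lia.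
  exists C => //; apply: subgraph_le_trans leC _.
  by rewrite /subgraph_le /= subxx subsetDl.
have [r2|] := boolP (regular 2 K).
  have /card_gt0P[x xK] := vK.
  by exists (component K x); [exact: component_cycle|exact: component_le].
case/forall_inPn=> w wK dw.
have [v vK' dv] : exists2 v, v \in verts K & degree K v < 2.
  apply/exists_inP; apply: contraT => /exists_inPn h.
  have := handshake K (verts K).
  rewrite inner_verts boundary_verts cards0 addn0.
  have : \sum_(v in verts K) 2 < \sum_(v in verts K) degree K v.
    rewrite [ltnRHS](bigD1 w) // [ltnLHS](bigD1 w) //= -addSn leq_add //.
      by have := h w wK; lia.
    by apply: leq_sum => v /andP[vK' _]; have := h v vK'; lia.
  rewrite sum_nat_const; lia.
have := inner_del K vK'; rewrite inner_verts.
have := degree_restrict K (verts K) v.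
have := cardsD1 v (verts K); rewrite vK' => cv dr ci.
(* The remainder is nonempty because a single vertex carries no edge in a loopless graph. *)
have v0 : 0 < #|verts K :\ v|.
  rewrite lt0n; apply: contraTneq (leq_trans vK veK) => /eqP.
  rewrite cards_eq0 setD_eq0 => sv.
  rewrite -inner_verts; suff -> : verts K = [set v] by rewrite inner1 cards0.
  by apply/eqP; rewrite eqEsubset sv sub1set.
have [||C cC leC] := IH (restrict K (verts K :\ v)); rewrite /=; try lia.
exists C => //; apply: subgraph_le_trans leC _.
exact/restrict_le/subsetDl.
Qed.

Lemma cycle_verts C : is_cycle C -> exists x, x \in verts C.
Proof. by case/andP=> /andP[/set0Pn]. Qed.

Lemma cycle_degree C x : is_cycle C -> x \in verts C -> degree C x = 2.
Proof. by case/andP=> _ /forall_inP r2 /r2/eqP. Qed.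

Lemma cycle_card C : is_cycle C -> #|edges C| = #|verts C|.
Proof.
move=> cC; have := handshake C (verts C).
rewrite inner_verts boundary_verts cards0 addn0.
rewrite (eq_bigr (fun=> 2)) ?sum_nat_const => [|v vC]; first by lia.
exact: cycle_degree.
Qed.

Lemma cycle_card_gt1 C : is_cycle C -> 1 < #|verts C|.
Proof.
move=> cC; have [x xC] := cycle_verts cC.
have [|e eC _] := @degree_edge _ C x; first by rewrite cycle_degree.
by have := subset_leq_card (edge_verts eC); rewrite card_endsE.
Qed.

Lemma boundary_closed A x y : x \in A ->
  adj (del_edges (boundary (whole G) A)) x y -> y \in A.
Proof.
move=> xA /adjP[e]; rewrite inE => eb E; apply: contraNT eb => yA.
by apply/boundaryP; split; [rewrite inE|exists x, y].
Qed.

(** No remaining edge leaves [A], so the two cycles survive in different components, which are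
    therefore not trees. *)
Lemma cyclic_cut A C1 C2 : is_cycle C1 -> is_cycle C2 ->
  verts C1 \subset A -> verts C2 \subset ~: A ->
  cyclic_edge_cut (boundary (whole G) A).
Proof.
move=> c1 c2 s1 s2; pose D := del_edges (boundary (whole G) A).
have [x1 x1C] := cycle_verts c1; have [x2 x2C] := cycle_verts c2.
have xA := subsetP s1 _ x1C.
have xA' : x2 \notin A by have := subsetP s2 _ x2C; rewrite inE.
have leD C : is_cycle C -> (verts C \subset A) || (verts C \subset ~: A) -> subgraph_le C D.
  move=> cC sC; apply/andP; split; first by apply/subsetP=> z; rewrite inE.
  apply/subsetP=> e /edge_verts sE; rewrite inE; apply/negP.
  case/boundaryP=> _ [x [y [xi yi E]]]; move: sC sE; rewrite E.
  case/orP=> sC sE; have sA := subset_trans sE sC.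
    by move: yi; rewrite (subsetP sA) // !inE eqxx orbT.
  by have := subsetP sA x; rewrite !inE eqxx xi /= => /(_ isT).
have nt C x : is_cycle C -> x \in verts C -> subgraph_le C D -> ~ is_tree (component D x).
  move=> cC xC le [_ /(_ C)]; rewrite cC => /(_ _)/negP; apply=> //.
  by apply: le_component => //; case/andP: cC.
split.
  apply/negP=> cD; have : A = verts D.
    apply: connected_closed => //; first exact: subsetT.
      by apply/set0Pn; exists x1.
    by move=> x y; exact: boundary_closed.
  by move=> EA; move: xA'; rewrite EA inE.
exists (component D x1), (component D x2); split.
- by apply: component_is_component; rewrite inE.
- by apply: component_is_component; rewrite inE.
- move=> E; have : x2 \in verts (component D x1) by rewrite E mem_component // inE.
  rewrite inE => /andP[_].
  move=> x12; case/negP: xA'.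
  by apply: (connect_inv (P := fun z => z \in A)) xA x12 => u v; exact: boundary_closed.
- by apply: (nt _ _ c1 x1C); apply: leD; rewrite ?s1.
by apply: (nt _ _ c2 x2C); apply: leD; rewrite ?s2 ?orbT.
Qed.

Lemma nontree_card K : connected K -> ~ is_tree K -> 1 < #|verts K|.
Proof.
move=> cK nt; rewrite ltnNge; apply/negP=> le1; apply: nt; split=> // C.
case/andP=> vC _; apply/negP=> cC; have := subset_leq_card vC.
by have := cycle_card_gt1 cC; lia.
Qed.

Definition n_inner A := #|inner (whole G) A|.
Definition n_boundary A := #|boundary (whole G) A|.

(* For a cubic graph with two disjoint cycles this is equivalent to cyclic
   4-edge-connectivity, without reference to cycles or components. *)
Definition essentially_4 := forall A, 1 < #|A| -> 1 < #|~: A| -> 3 < n_boundary A.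

(** A component that is not a tree has at least two vertices, and so does its complement, which
    contains the other such component; every edge leaving it belongs to [F]. *)
Lemma essentially_4_cut F : essentially_4 -> cyclic_edge_cut F -> 4 <= #|F|.
Proof.
move=> e4 [_ [K1 [K2 [c1 c2 n12 nt1 nt2]]]].
have cK1 : connected K1 by case: c1.
have cK2 : connected K2 by case: c2.
have dis : verts K2 \subset ~: verts K1.
  apply/subsetP=> x xK2; rewrite inE; apply/negP=> xK1; apply: n12.
  by rewrite (component_unique c1 xK1) (component_unique c2 xK2).
apply: leq_trans (e4 (verts K1) _ _) _.
- exact: nontree_card.
- exact: leq_trans (nontree_card cK2 nt2) (subset_leq_card dis).
apply/subset_leq_card/subsetP=> e /boundaryP[_ [x [y [xK yK E]]]].
apply: contraNT yK => eF; rewrite (component_unique c1 xK).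
have xe : x \in ends e by rewrite E !inE eqxx.
have ye : y \in ends e by rewrite E !inE eqxx orbT.
rewrite inE (edge_connect _ xe ye) ?inE //.
Qed.

Lemma n_inner_cycle A : 0 < #|A| <= n_inner A ->
  exists2 C, is_cycle C & verts C \subset A.
Proof.
move=> h; have [C cC /andP[sC _]] := @exists_cycle (restrict (whole G) A) h.
by exists C.
Qed.

Lemma cycle_n_inner C : is_cycle C -> #|verts C| <= n_inner (verts C).
Proof.
move=> cC; rewrite -cycle_card //; apply/subset_leq_card/subsetP=> e eC.
by rewrite !inE edge_verts.
Qed.

Hypothesis cG : cubic G.

Lemma cubic_degree v : degree (whole G) v = 3.
Proof. by apply/eqP; move/forall_inP: cG; apply; rewrite inE. Qed.

Lemma cubic_handshake A : 3 * #|A| = (n_inner A).*2 + n_boundary A.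
Proof.
have := handshake (whole G) A; under eq_bigr => v _ do rewrite cubic_degree.
by rewrite sum_nat_const mulnC.
Qed.

(** A closed set has empty boundary, so one side has at most one vertex. Exactly one is impossible,
    since [cubic_handshake] would make 3 even. *)
Lemma essentially_4_connected : essentially_4 -> 0 < #|vertex G| -> connected (whole G).
Proof.
move=> e4 n0; apply: closed_connected.
  by rewrite -card_gt0 cardsT.
move=> A _ A0 clA; apply/eqP; rewrite eqEsubset subsetT /=.
have b0 : n_boundary A = 0.
  apply/eqP; rewrite cards_eq0; apply/eqP/setP=> e; rewrite [RHS]inE; apply/negP.
  case/boundaryP=> eG [x [y [xA yA E]]]; move: yA; rewrite (clA x) //.
  by apply/adjP; exists e.
have := cubic_handshake A; have := cubic_handshake (~: A).
rewrite /n_boundary boundaryC -/(n_boundary A) b0 !addn0 -setCS setCT subset0 -cards_eq0.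
move: A0; rewrite -card_gt0.
by have := e4 A; rewrite b0; lia.
Qed.

Lemma essentially_4_c4ec : essentially_4 -> two_disjoint_cycles G ->
  cyclically_4_edge_connected G.
Proof.
move=> e4 cyc; have [C1 [C2 [c1 c2 dis]]] := cyc.
have [x xC] := cycle_verts c1.
split=> //; first by apply: essentially_4_connected => //; apply/card_gt0P; exists x.
have cut : exists F, cyclic_edge_cut F.
  exists (boundary (whole G) (verts C1)); apply: (cyclic_cut c1 c2) => //.
  by rewrite -disjoints_subset disjoint_sym.
(* Descent on the size yields a cyclic edge cut of minimum size, so that [is_lambda_c] holds for
   some number. *)
suff [F cF minF] : exists2 F : {set edge G}, cyclic_edge_cut F &
    forall F' : {set edge G}, cyclic_edge_cut F' -> #|F| <= #|F'|.
  by exists #|F|; [split=> //; exists F|exact: essentially_4_cut].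
have [F] := cut; have [n] := ubnP #|F|; elim: n F => // n IH F lt_n cF.
have [[F' [cF' lt]]|no] := classic (exists F', cyclic_edge_cut F' /\ #|F'| < #|F|).
  by apply: (IH F') => //; lia.
exists F => // F' cF'; rewrite leqNgt; apply/negP=> lt; apply: no.
by exists F'.
Qed.

End Cycles.

(** * The inflation of a cubic graph *)

Lemma cubic_card (G : mgraph) : cubic G -> 3 * #|vertex G| = #|edge G|.*2.
Proof.
move=> cG; have := cubic_handshake cG [set: vertex G].
have -> : n_boundary [set: vertex G] = 0 by rewrite /n_boundary (boundary_verts (whole G)) cards0.
by rewrite /n_inner (inner_verts (whole G)) !cardsT addn0.
Qed.

(** With at most three boundary edges, [2 * n_inner A >= 3 * #|A| - 3 >= 2 * #|A| - 1], so [A]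
    induces at least [#|A|] edges and contains a cycle; likewise for the complement. *)
Lemma c4ec_essentially_4 (G : mgraph) : cyclically_4_edge_connected G -> essentially_4 G.
Proof.
case=> _ cG [k [_ _ mink] k4] A A1 A1'; rewrite ltnNge; apply/negP=> b3.
have h1 := cubic_handshake cG A; have h2 := cubic_handshake cG (~: A).
rewrite /n_boundary boundaryC -/(n_boundary A) in h2.
have [|C1 cC1 s1] := @n_inner_cycle _ A; first by lia.
have [|C2 cC2 s2] := @n_inner_cycle _ (~: A); first by lia.
have /mink := cyclic_cut cC1 cC2 s1 s2; rewrite -/(n_boundary A); lia.
Qed.

(** Disjoint cycles occupy at least four vertices, and a cubic graph on four vertices has six
    edges. *)
Lemma c4ec_card_edge (G : mgraph) : cyclically_4_edge_connected G -> 5 < #|edge G|.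
Proof.
case=> _ cG [k [[C1 [C2 [c1 c2 +]]] _ _] _]; rewrite disjoints_subset => /subset_leq_card.
have := cycle_card_gt1 c1; have := cycle_card_gt1 c2.
have := cubic_card cG; have := cardsC (verts C2); lia.
Qed.

(* [mu] sends a vertex to the edge of the perfect matching that covers it. *)
Lemma contract_proj_eq (G : mgraph) (M : {set edge G}) (mu : vertex G -> edge G) :
  (forall v e, (e \in M) && (v \in ends e) = (e == mu v)) ->
  forall x y, contract_proj M x = contract_proj M y <-> mu x = mu y.
Proof.
move=> muE x y; have muM v : mu v \in M /\ v \in ends (mu v).
  by apply/andP; rewrite muE.
split=> [E|E].
  have : y \in contract_class M x.
    by move/(congr1 val): E => /= ->; rewrite inE connect0.
  rewrite inE; apply: (connect_inv (P := fun z => mu x = mu z)) => //.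
  move=> u v -> /adjP[e eM Ee]; rewrite /= in eM.
  have := muE u e; have := muE v e; rewrite Ee !inE !eqxx eM orbT /=.
  by move=> /esym/eqP <- /esym/eqP <-.
have xy : connect (adj (spanning M)) x y.
  apply: (@edge_connect _ (spanning M) (mu x)); rewrite ?(muM _).1 ?(muM _).2 //.
  by rewrite E (muM y).2.
apply: val_inj => /=; apply/setP=> z; rewrite !inE.
exact: same_connect (connect_adj_sym _) _ _ xy z.
Qed.

Lemma contract_surj (G : mgraph) (M : {set edge G}) (c : vertex (contract M)) :
  exists v, c = contract_proj M v.
Proof. by case: c => B BP; have /codomP[v E] := BP; exists v; apply: val_inj. Qed.

Section Inflation.
Variable G : mgraph.
Hypothesis cG : cubic G.

(** The vertices of the inflation: the three flags at [v] are the corners of the triangle replacing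
    [v]. *)
Definition flag : finType := {p : vertex G * edge G | p.1 \in ends p.2}.
Definition fv (p : flag) := (val p).1.
Definition fe (p : flag) := (val p).2.
Definition mkflag v e (ve : v \in ends e) : flag := exist _ (v, e) ve.

Lemma flagP p : fv p \in ends (fe p). Proof. exact: valP p. Qed.

Lemma flag_inj p q : fv p = fv q -> fe p = fe q -> p = q.
Proof. by case: p q => [[a b] i] [[c d] j] /= e1 e2; apply: val_inj; congr pair. Qed.

(* [inl e] replaces the edge [e]; [inr (v, e)] is the side opposite to the
   corner [(v, e)] in the triangle replacing [v]. *)
Definition inf_ends (a : edge G + flag) : {set flag} :=
  match a with
  | inl e => [set p | fe p == e]
  | inr q => [set p | (fv p == fv q) && (fe p != fe q)]
  end.

Definition star v : {set edge G} := [set e | v \in ends e].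

Lemma card_star v : #|star v| = 3.
Proof. by rewrite -(cubic_degree cG v); apply: eq_card => e; rewrite !inE. Qed.

Lemma inf_card_ends a : #|inf_ends a| == 2.
Proof.
case: a => [e|q] /=.
  rewrite -(@card_in_imset _ _ fv) => [|p p']; last first.
    by rewrite !inE => /eqP h /eqP h' /flag_inj; apply; rewrite h h'.
  rewrite -(card_endsE e); apply/eqP; apply: eq_card => x.
  apply/imsetP/idP=> [[p]|xe]; first by rewrite inE => /eqP<- ->; exact: flagP.
  by exists (mkflag xe); rewrite ?inE.
rewrite -(@card_in_imset _ _ fe) => [|p p']; last first.
  by rewrite !inE => /andP[/eqP h _] /andP[/eqP h' _] /(flag_inj _); apply; rewrite h h'.
have := cardsD1 (fe q) (star (fv q)); rewrite card_star inE flagP add1n => -[] E.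
apply/eqP; rewrite E; apply: eq_card => e; rewrite !inE.
apply/imsetP/andP=> [[p]|[eq ve]].
  by rewrite inE => /andP[/eqP pq pe] ->; rewrite pe -pq flagP.
by exists (mkflag ve); rewrite ?inE ?eqxx.
Qed.

Definition inflation : mgraph := MGraph inf_card_ends.
Definition spokes : {set edge inflation} := [set a | if a is inl _ then true else false].

Lemma inflation_cubic : cubic inflation.
Proof.
apply/forall_inP=> /= p _; rewrite /degree.
(* Being a corner other than a given one is a symmetric relation, so the sides at [p] are those
   opposite to the two other corners. *)
have -> : [set a in edges (whole inflation) | p \in ends a] =
    inl (fe p) |: inr @: inf_ends (inr p).
  apply/setP=> -[e|q]; rewrite !inE /=.
    rewrite eq_sym; case: eqP => [->|ne]; first by rewrite eqxx.
    have /negPf-> : inl e != inl (fe p) :> edge G + flag by apply/eqP=> -[].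
    by apply/esym/imsetP=> -[].
  rewrite mem_imset; last by move=> ? ? [].
  by rewrite inE /= eq_sym; congr (_ && _); rewrite eq_sym.
rewrite cardsU1 card_imset; last by move=> ? ? [].
rewrite (eqP (inf_card_ends (inr p))).
by case: imsetP => // -[].
Qed.

Lemma spokesE (p : vertex inflation) (a : edge inflation) :
  (a \in spokes) && (p \in ends a) = (a == inl (fe p)).
Proof.
case: a => [e|q]; rewrite !inE //=.
by apply/eqP/eqP=> [->|[->]].
Qed.

Lemma spokes_perfect : perfect_matching spokes.
Proof.
apply/andP; split; last first.
  apply/forallP=> p; apply/exists_inP; exists (inl (fe p)); rewrite inE //=.
apply/forall_inP; case=> [e _|q]; last by rewrite inE.
apply/forall_inP; case=> [f _|q]; last by rewrite inE.
apply/implyP=> ef.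
rewrite -setI_eq0; apply/eqP/setP=> p; rewrite !inE; apply: contraNF ef.
by case/andP=> /eqP<- /eqP<-.
Qed.

Notation proj := (contract_proj (G := inflation) spokes).

Lemma proj_eq p q : proj p = proj q <-> fe p = fe q.
Proof.
rewrite (contract_proj_eq (G := inflation) (mu := fun p : flag => inl (fe p)) spokesE).
by split=> [[]|->].
Qed.

Lemma flag_of_ex e : exists p, fe p == e.
Proof.
have [x [y [_ E]]] := endsP e; have xe : x \in ends e by rewrite E !inE eqxx.
by exists (mkflag xe); rewrite /fe.
Qed.

(** Both flags of [e] have the same image, which makes the edges of [G] the vertices of the
    contraction. *)
Definition edge_class e : vertex (contract spokes) := proj (xchoose (flag_of_ex e)).

Lemma edge_classE p : edge_class (fe p) = proj p.
Proof. by apply/proj_eq/eqP; exact: xchooseP (flag_of_ex _). Qed.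

Lemma edge_class_inj : injective edge_class.
Proof.
move=> e f /proj_eq.
by rewrite (eqP (xchooseP (flag_of_ex e))) (eqP (xchooseP (flag_of_ex f))).
Qed.

(** As the degree is 3, there is a third corner [r] at the common vertex, and the side opposite to
    [r] joins [p] to [q]. Hence edges of [G] sharing an end become adjacent, as in the line
    graph. *)
Lemma inflation_adj (X : {set vertex (contract spokes)}) (p q : flag) :
  fv p = fv q -> fe p != fe q ->
  proj p \notin X -> proj q \notin X ->
  adj (G := contract spokes) (del_verts X) (proj p) (proj q).
Proof.
move=> vpq epq pX qX.
have [r vr [rp rq]] : exists2 r, fv r = fv p & fe r != fe p /\ fe r != fe q.
  have : 0 < #|star (fv p) :\ fe p :\ fe q|.
    have := cardsD1 (fe p) (star (fv p)).
    have := cardsD1 (fe q) (star (fv p) :\ fe p).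
    by rewrite card_star !inE flagP eq_sym epq vpq flagP /=; lia.
  case/card_gt0P=> e; rewrite !inE => /and3P[eq ep ve].
  by exists (mkflag ve).
have E : ends (m := inflation) (inr r) = [set p; q].
  by apply: ends_pair; rewrite ?inE /= ?vr ?vpq ?eqxx // eq_sym // ;
    apply: contraNneq epq => ->.
have im : proj @: ends (m := inflation) (inr r) = [set proj p; proj q].
  by rewrite E imsetU1 imset_set1.
have c2 : #|proj @: ends (m := inflation) (inr r)| == 2.
  rewrite im cards2; have [E'|//] := eqVneq (proj p) (proj q).
  by case/eqP: epq; apply/proj_eq.
apply/adjP; exists (exist _ (inr r) c2); rewrite ?inE /= /contract_ends /= im //.
by apply/subsetP=> z; rewrite !inE => /orP[]/eqP->.
Qed.

Lemma inflation_4_connected : cyclically_4_edge_connected G ->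
  k_connected 4 (contract spokes).
Proof.
move=> c4; have e4 := c4ec_essentially_4 c4.
have cE : 5 < #|vertex (contract spokes)|.
  by apply: leq_trans (c4ec_card_edge c4) _; rewrite -(card_codom edge_class_inj) max_card.
split; first by lia.
move=> X X4; apply: closed_connected => [|P PX P0 clP].
  rewrite -card_gt0 -[verts _]/(~: X); move: cE X4; rewrite -(cardsC X).
  by case: #|~: X| => //; lia.
apply/eqP; rewrite eqEsubset PX; apply/subsetP=> c /=; rewrite inE.
have [q0 {c}->] := contract_surj c => q0X; apply: contraLR X4 => q0P; rewrite -leqNgt.
have step (p q : flag) : fv p = fv q -> proj p \in P -> proj q \notin X -> proj q \in P.
  move=> vpq pP qX; have [/proj_eq<-//|epq] := eqVneq (fe p) (fe q).
  have pX : proj p \notin X by have := subsetP PX _ pP; rewrite inE.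
  by apply: clP pP _; apply: inflation_adj.
(* The ends of the edges whose class lies in [P]. An edge leaving [A] must have its class in [X], so
   the cut of [A] has at most [#|X|] edges. *)
pose A := [set v | [exists p : flag, (fv p == v) && (proj p \in P)]].
have inA (p : flag) x : proj p \in P -> x \in ends (fe p) -> x \in A.
  move=> pP xp; rewrite inE; apply/existsP; exists (mkflag xp); rewrite eqxx /=.
  by have /proj_eq -> : fe (mkflag xp) = fe p by [].
have stepA x e : x \in A -> x \in ends e -> edge_class e \notin X -> edge_class e \in P.
  rewrite inE => /existsP[p /andP[/eqP vp pP]] xe.
  by have := edge_classE (mkflag xe) => -> eX; apply: step pP eX.
apply: leq_trans (e4 A _ _) _.
- have /set0Pn[c cP] := P0; have [p E] := contract_surj c; rewrite E in cP.
  by rewrite -(card_endsE (fe p)); apply/subset_leq_card/subsetP=> x /(inA _ _ cP).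
(* The edge of [q0], with class neither in [P] nor in [X], has both ends outside [A]. *)
- rewrite -(card_endsE (fe q0)); apply/subset_leq_card/subsetP=> x xq0.
  rewrite inE; apply: contraNN q0P => xA.
  by rewrite -edge_classE; apply: stepA xA xq0 _; rewrite edge_classE.
rewrite /n_boundary -(card_imset _ edge_class_inj); apply/subset_leq_card/subsetP=> c.
case/imsetP=> e /boundaryP[_ [x [y [xA yA E]]]] ->.
have xe : x \in ends e by rewrite E !inE eqxx.
have ye : y \in ends e by rewrite E !inE eqxx orbT.
apply: contraNT yA => eX; have := stepA x e xA xe eX.
have := edge_classE (mkflag xe) => -> pP; exact: inA pP ye.
Qed.

(** * Shrinking a cycle of the inflation *)

Section Deflate.
Variable C : subgraph inflation.
Hypothesis cC : is_cycle C.
Hypothesis domC : dominates C spokes.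
Hypothesis cardE : 5 < #|edge G|.

Lemma deflate_proof : [forall e in [set e | inl e \in edges C], ends e \subset fv @: verts C].
Proof.
apply/forall_inP=> e; rewrite inE => eC; apply/subsetP=> x xe.
apply/imsetP; exists (mkflag xe) => //; apply: (edge_vert eC).
by rewrite inE.
Qed.

Definition deflate : subgraph G := Subgraph deflate_proof.

Lemma deflate_connected : connected deflate.
Proof.
have /andP[/andP[/set0Pn[p0 p0C] /forall_inP ccC] _] := cC.
apply/andP; split; first by apply/set0Pn; exists (fv p0); exact: imset_f.
apply/forall_inP=> x /imsetP[p pC ->]; apply/forall_inP=> y /imsetP[q qC ->].
have /forall_inP/(_ q qC) := ccC p pC.
apply: (connect_inv (P := fun r => connect (adj deflate) (fv p) (fv r))) => // r s pr.
case/adjP=> a aC E; apply: connect_trans pr _.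
have : (r \in ends a) /\ (s \in ends a) by rewrite E !inE !eqxx orbT.
case: a aC {E} => [e|t] aC; rewrite !inE.
  case=> /eqP er /eqP es; apply: (@edge_connect _ _ e); rewrite ?inE //.
    by rewrite -er flagP.
  by rewrite -es flagP.
by case=> /andP[/eqP-> _] /andP[/eqP-> _]; exact: connect0.
Qed.

(** The edges of [C] leaving the triangle of [v] are the old edges at [v], and their number is even
    because degrees in [C] are 0 or 2. It is at most 3, and not 0: otherwise [C] would stay in that
    triangle, and domination would put all edges of [G], more than five, at [v]. *)
Lemma deflate_degree v : v \in fv @: verts C -> degree deflate v = 2.
Proof.
case/imsetP=> p pC vp; pose A : {set vertex inflation} := [set q | fv q == v].
have dE : [set e in edges deflate | v \in ends e] = [set e | (inl e \in edges C) && (v \in ends e)].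
  by apply/setP=> e; rewrite !inE.
have d0 : 0 < degree deflate v.
  rewrite lt0n; apply/negP=> d0.
  have allv q : q \in verts C -> fv q = v.
    have /andP[/andP[_ /forall_inP/(_ p pC)/forall_inP h] _] := cC.
    move/h; apply: (connect_inv (P := fun r => fv r = v)) => //.
    move=> r s vr /adjP[a aC E].
    have : (r \in ends a) /\ (s \in ends a) by rewrite E !inE !eqxx orbT.
    case: a aC {E} => [e|t] aC; rewrite !inE.
      case=> /eqP er _; have : 0 < degree deflate v; last by rewrite (eqP d0).
      by apply: (@degree_gt0 _ _ e); rewrite ?inE // -vr -er flagP.
    by case=> /andP[/eqP rt _] /andP[/eqP-> _]; rewrite -rt.
  have : #|[set: edge G]| <= #|star v|.
    apply/subset_leq_card/subsetP=> e _; rewrite inE.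
    have [|q] := domC (e := inl e); first by rewrite inE.
    by rewrite inE => /eqP<- /allv<-; exact: flagP.
  by rewrite cardsT card_star; lia.
have d3 : degree deflate v <= 3.
  rewrite -(card_star v); apply/subset_leq_card/subsetP=> e.
  by rewrite !inE => /andP[].
have bE : boundary C A = inl @: [set e in edges deflate | v \in ends e].
  apply/setP=> a; apply/boundaryP/imsetP.
    case=> aC [q [r [qA rA E]]]; rewrite !inE in qA rA.
    have : (q \in ends a) /\ (r \in ends a) by rewrite E !inE !eqxx orbT.
    case: a aC {E} => [e|t] aC; rewrite !inE.
      by case=> /eqP qe _; exists e; rewrite // !inE aC -qe -(eqP qA) flagP.
    by case=> /andP[/eqP qt _] /andP[/eqP rt _]; rewrite rt -qt qA in rA.
  case=> e; rewrite !inE => /andP[eC ve] ->; split=> //.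
  have [w wv E] := ends_other ve.
  have we : w \in ends e by rewrite E !inE eqxx orbT.
  exists (mkflag ve), (mkflag we); split; rewrite ?inE ?eqxx //.
  apply: ends_pair; rewrite ?inE //; apply: contraNneq wv => /(congr1 fv) vw.
  exact/eqP/esym.
have := handshake C A; rewrite bE card_imset; last by move=> ? ? [].
rewrite -/(degree deflate v).
have -> : \sum_(q in A) degree C q = \sum_(q in A) (q \in verts C) * 2.
  apply: eq_bigr => q _; have [qC|qC] := boolP (q \in verts C).
    by rewrite (cycle_degree cC qC).
  apply/eqP; rewrite mul0n -leqn0 leqNgt; apply: contraNN qC.
  by case/degree_edge=> a aC; exact: edge_vert.
rewrite -big_distrl /=; move: d0 d3; lia.
Qed.

Lemma deflate_dominating : dominating_cycle deflate.
Proof.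
split; last first.
  move=> e _; have [|p] := domC (e := inl e); first by rewrite inE.
  by rewrite inE => /eqP<- pC; exists (fv p); [exact: flagP|exact: imset_f].
apply/andP; split; first exact: deflate_connected.
by apply/forall_inP=> v vC; rewrite deflate_degree.
Qed.

End Deflate.
End Inflation.

Lemma matching_to_dominating :
  (forall (G : mgraph) (M : {set edge G}),
     cubic G -> perfect_matching M -> k_connected 4 (contract M) ->
     exists C : subgraph G, is_cycle C /\ dominates C M) ->
  forall G : mgraph, cyclically_4_edge_connected G ->
     exists C : subgraph G, dominating_cycle C.
Proof.
move=> hA G c4; have cG : cubic G by case: c4.
have [C [cC domC]] := hA _ _ (inflation_cubic cG) (spokes_perfect cG) (inflation_4_connected cG c4).
exists (deflate C); apply: deflate_dominating => //; exact: c4ec_card_edge.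
Qed.

(** * Cubic graphs without two disjoint cycles *)

Section NoTwoDisjointCycles.
Variable G : mgraph.
Hypothesis cG : cubic G.
Hypothesis e4 : essentially_4 G.
Hypothesis nonempty : 0 < #|vertex G|.
Implicit Types (e : edge G) (x y v : vertex G) (A S T U : {set vertex G}).

Definition inner_degree A v := degree (restrict (whole G) A) v.

Lemma n_inner_del A v : v \in A -> n_inner A = n_inner (A :\ v) + inner_degree A v.
Proof. exact: inner_del. Qed.

Lemma inner_degree_le3 A v : inner_degree A v <= 3.
Proof. by rewrite -(cubic_degree cG v); exact: degree_restrict. Qed.

Lemma sum_inner_degree A : \sum_(v in A) inner_degree A v = (n_inner A).*2.
Proof.
have := handshake (restrict (whole G) A) A; rewrite (boundary_verts (restrict _ A)).
by rewrite (inner_verts (restrict _ A)) cards0 addn0.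
Qed.

Lemma n_boundary0 A : n_boundary A = 0 -> #|A| = 0 \/ #|~: A| = 0.
Proof.
move=> b0; have h1 := cubic_handshake cG A; have h2 := cubic_handshake cG (~: A).
rewrite /n_boundary boundaryC -/(n_boundary A) in h2.
have := e4 (A := A); lia.
Qed.

(** Each of the three edges at [u] has its other end either in [S] or outside. *)
Lemma inner_degree_compl S u : u \notin S -> 3 <= inner_degree (~: S) u + inner_degree (u |: S) u.
Proof.
move=> uS; rewrite -(cubic_degree cG u) /inner_degree /degree -cardsUI.
apply: leq_trans (leq_addr _ _); apply/subset_leq_card/subsetP=> e.
rewrite !inE /= => ue; rewrite ue !andbT; have [w wu ->] := ends_other ue.
have [wS|wS] := boolP (w \in S); apply/orP; [right|left]; apply/subsetP=> z;
  by rewrite !inE => /orP[]/eqP->; rewrite ?wS ?uS ?eqxx ?orbT.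
Qed.

Lemma n_inner1 v : n_inner [set v] = 0.
Proof. by rewrite /n_inner inner1 cards0. Qed.

Hypothesis no2 : ~ two_disjoint_cycles G.

Lemma no_disjoint_cyclic A : 0 < #|A| <= n_inner A -> 0 < #|~: A| -> n_inner (~: A) < #|~: A|.
Proof.
move=> cA A0; rewrite ltnNge; apply/negP=> cA'; apply: no2.
have [C1 c1 s1] := n_inner_cycle cA.
have [|C2 c2 s2] := @n_inner_cycle _ (~: A); first by rewrite A0.
exists C1, C2; split=> //; rewrite disjoints_subset.
by apply: subset_trans s1 _; rewrite -setCS setCK.
Qed.

(* If there were more than six vertices, take a smallest set [S] inducing as many
   edges as it has vertices, and a vertex [u] outside it with two neighbours in
   [S] (three would force [K_4]).  By minimality the vertices of degree two in
   [u |: S] form an independent set of size at least [#|S| - 1], whereas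
   [u |: S] induces only [#|S| + 2] edges. *)
Lemma card_vertex_le6 : #|vertex G| <= 6.
Proof.
have h := cubic_card cG; rewrite leqNgt; apply/negP=> n7.
have ninT : n_inner [set: vertex G] = #|edge G|.
  by rewrite /n_inner (inner_verts (whole G)) cardsT.
pose P A := 0 < #|A| <= n_inner A.
have PT : P [set: vertex G] by rewrite /P ninT cardsT; lia.
case: (arg_minnP (fun A : {set vertex G} => #|A|) PT) => S0 PS0 minS0.
have [S PS minS] : exists2 S : {set vertex G}, P S & forall T : {set vertex G}, P T -> #|S| <= #|T|.
  by exists S0.
move=> {S0 PS0 minS0}.
have {PT} minN T : 0 < #|T| -> #|T| < #|S| -> n_inner T < #|T|.
  move=> T0 ltT; rewrite ltnNge; apply/negP=> cT.
  by have := minS T; rewrite /P T0 cT; lia.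
have S2 : 1 < #|S|.
  rewrite ltnNge; apply/negP=> S1; case/andP: PS => S0.
  have /cards1P[v ->] : #|S| == 1 by lia.
  by rewrite n_inner1 cards1.
(* By minimality of [S], deleting any vertex of a counterexample [T] loses at least three edges. So
   [T] has no boundary and is the whole vertex set, which has too many vertices for this. *)
have le_s T : #|T| = #|S| -> n_inner T <= #|S|.
  move=> Ts; rewrite leqNgt; apply/negP=> ltT.
  have d3 v : v \in T -> inner_degree T v = 3.
    move=> vT; have := n_inner_del vT; have := cardsD1 v T; rewrite vT.
    have := minN (T :\ v); have := inner_degree_le3 T v; lia.
  have : \sum_(v in T) inner_degree T v = 3 * #|T|.
    by rewrite (eq_bigr (fun=> 3)) ?sum_nat_const 1?mulnC.
  rewrite sum_inner_degree; have := cubic_handshake cG T => hT sT.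
  have [] := @n_boundary0 T; [lia|lia|]; move/eqP.
  rewrite cards_eq0 => /eqP Tc; have TT : T = setT by rewrite -[T]setCK Tc setC0.
  have /card_gt0P[v _] : 0 < #|[set: vertex G]| by rewrite cardsT.
  have cSn : #|vertex G| = #|S| by rewrite -Ts TT cardsT.
  have c1 : #|S| = #|[set: vertex G] :\ v|.+1 by rewrite -cSn -cardsT (cardsD1 v) inE.
  have := n_inner_del (in_setT v); rewrite ninT.
  have := minN (setT :\ v); have := inner_degree_le3 setT v; lia.
have eS : n_inner S = #|S| by apply/eqP; rewrite eqn_leq le_s //; case/andP: PS.
have cS := cardsC S.
have hS := cubic_handshake cG S; have hS' := cubic_handshake cG (~: S).
rewrite /n_boundary boundaryC -/(n_boundary S) in hS'.
have S'0 : 0 < #|~: S|.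
  rewrite lt0n; apply/negP=> /eqP S'0; have SV : #|S| = #|[set: vertex G]| by rewrite cardsT; lia.
  by have := le_s _ (esym SV); rewrite SV ninT cardsT; lia.
have nS' := no_disjoint_cyclic PS S'0.
have [u uS du] : exists2 u, u \in ~: S & inner_degree (~: S) u < 2.
  apply/exists_inP; apply: contraT => /exists_inPn hd.
  have : \sum_(v in ~: S) 2 <= \sum_(v in ~: S) inner_degree (~: S) v.
    by apply: leq_sum => v vS; have := hd v vS; lia.
  by rewrite sum_nat_const sum_inner_degree; lia.
rewrite inE in uS; have dU := inner_degree_compl uS.
set U := u |: S in dU; have uU : u \in U by rewrite !inE eqxx.
have cU : #|U| = #|S|.+1 by rewrite cardsU1 uS.
have nU := n_inner_del uU; rewrite setU1K // eS in nU.
(* [U :\ x] has [#|S|] vertices, hence at most [#|S|] edges, while deleting [u] leaves exactly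
   [#|S|]. *)
have dUx x : x \in U -> inner_degree U u <= inner_degree U x.
  move=> xU; have := n_inner_del xU; have := cardsD1 x U; rewrite xU cU.
  by have := le_s (U :\ x); lia.
have sU := sum_inner_degree U.
have hU := cubic_handshake cG U; have := inner_degree_le3 U u.
have [d3|d3] := eqVneq (inner_degree U u) 3.
  move=> _; have : \sum_(v in U) 3 <= \sum_(v in U) inner_degree U v.
    by apply: leq_sum => v /dUx; rewrite d3.
  rewrite sum_nat_const sU; have := @n_boundary0 U; have := cardsC U; lia.
move=> dle; have d2 : inner_degree U u = 2 by lia.
pose D := [set x in U | inner_degree U x == 2].
(* Deleting two adjacent vertices of [D] would lose at most three of the [#|S| + 2] edges, leaving
   as many edges as vertices on a set smaller than [S]. *)
have inD : inner (restrict (whole G) U) D = set0.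
  apply/setP=> e; rewrite [RHS]inE; apply/negP; rewrite inE => /andP[eU].
  have [x [y [xy E]]] := endsP e; rewrite E => /subsetP sD.
  have /setIdP[xU /eqP dx] : x \in D by apply: sD; rewrite !inE eqxx.
  have /setIdP[yU /eqP dy] : y \in D by apply: sD; rewrite !inE eqxx orbT.
  have yU' : y \in U :\ x by rewrite in_setD1 eq_sym xy.
  have := n_inner_del xU; have := n_inner_del yU'.
  have := cardsD1 x U; have := cardsD1 y (U :\ x); rewrite xU yU'.
  have := minN (U :\ x :\ y).
  suff : inner_degree (U :\ x) y < inner_degree U y by lia.
  apply/proper_card/properP; split.
    apply/subsetP=> f; rewrite !inE => /andP[/= sf ->]; rewrite andbT.
    exact: subset_trans sf (subsetDl _ _).
  exists e; rewrite !inE E !inE /= ?eqxx ?orbT ?andbT.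
    by apply/subsetP=> z /set2P[]->.
  by apply/negP=> /subsetP/(_ x); rewrite !inE eqxx /= => /(_ isT).
(* Independence of [D] gives [2 * #|D| <= #|S| + 2], and the degree sum over [U] gives
   [#|D| >= #|S| - 1], so [#|S| <= 4]. As [~: S] induces fewer edges than vertices,
   [#|~: S| <= #|S| - 2]. *)
have := handshake (restrict (whole G) U) D; rewrite inD cards0 add0n.
have -> : \sum_(v in D) degree (restrict (whole G) U) v = \sum_(v in D) 2.
  by apply: eq_bigr => v; rewrite inE => /andP[_ /eqP].
rewrite sum_nat_const.
have : #|boundary (restrict (whole G) U) D| <= n_inner U.
  by apply/subset_leq_card/subsetP=> e; rewrite inE => /andP[].
have : \sum_(v in U) (3 - (v \in D)) <= \sum_(v in U) inner_degree U v.
  apply: leq_sum => v vU; rewrite inE vU /=; have := dUx v vU; rewrite d2.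
  by case: eqP => //; lia.
have : \sum_(v in U) (3 - (v \in D)) + \sum_(v in U) (v \in D) = \sum_(v in U) 3.
  by rewrite -big_split; apply: eq_bigr => v _ /=; case: (v \in D).
rewrite card_mem_sum sum_nat_const (setIidPl (_ : D \subset U)); last first.
  by apply/subsetP=> v; rewrite inE => /andP[].
by rewrite sU; lia.
Qed.

Lemma spanning_cycle_dominating (C : subgraph G) : is_cycle C -> #|~: verts C| <= 1 ->
  dominating_cycle C.
Proof.
move=> cC le1; split=> // e _; have [x [y [xy E]]] := endsP e.
have [xC|xC] := boolP (x \in verts C); first by exists x; rewrite // E !inE eqxx.
have [yC|yC] := boolP (y \in verts C); first by exists y; rewrite // E !inE eqxx orbT.
suff : 1 < #|~: verts C| by lia.
by apply/card_gt1P; exists x, y; rewrite !inE.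
Qed.

(** A cycle on two or three of the six vertices would have at most three boundary edges, so every
    component has at least four vertices. Two components do not fit, hence the 2-regular graph is a
    Hamiltonian cycle. *)
Lemma two_regular_dominating (F : {set edge G}) : #|vertex G| = 6 ->
  regular 2 (spanning F) -> exists C : subgraph G, dominating_cycle C.
Proof.
move=> n6 r2; have /card_gt0P[v _] := nonempty.
pose Cv w := component (spanning F) w.
have cyc w : is_cycle (Cv w) by apply: component_cycle; rewrite ?inE.
have c4 w : 3 < #|verts (Cv w)|.
  have := cycle_card_gt1 (cyc w); have := cycle_n_inner (cyc w).
  have := cubic_handshake cG (verts (Cv w)); have := cardsC (verts (Cv w)).
  have := e4 (A := verts (Cv w)); rewrite n6; lia.
exists (Cv v); apply: spanning_cycle_dominating => //.
have [->|/set0Pn[w]] := eqVneq (~: verts (Cv v)) set0; first by rewrite cards0.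
rewrite inE => wv; have := cardsC (verts (Cv v)); rewrite n6.
suff : #|verts (Cv w)| <= #|~: verts (Cv v)| by have := c4 v; have := c4 w; lia.
apply/subset_leq_card/subsetP=> z zw; rewrite inE; apply: contraNN wv => zv.
move: zw zv; rewrite !inE /= => zw /connect_trans; apply.
by rewrite connect_adj_sym.
Qed.

Lemma small_dominating : exists C : subgraph G, dominating_cycle C.
Proof.
have n6 := card_vertex_le6; have h := cubic_card cG.
have ninT : n_inner [set: vertex G] = #|edge G|.
  by rewrite /n_inner (inner_verts (whole G)) cardsT.
have [|C cC _] := @n_inner_cycle _ [set: vertex G]; first by rewrite ninT cardsT; lia.
have cb := cycle_card_gt1 cC; have cn := cycle_n_inner cC.
have cC' := cardsC (verts C).
have hC := cubic_handshake cG (verts C); have eC := e4 (A := verts C).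
(* With at most four vertices, [C] misses at most one: a two-vertex cycle among four vertices would
   have at most two boundary edges, with two vertices on each side. *)
have [n4|n4] := leqP #|vertex G| 4.
  by exists C; apply: spanning_cycle_dominating => //; lia.
(* Parity excludes five vertices. On six, two, three or four vertices induce at most one, two or
   four edges, so there are neither parallel edges nor triangles. *)
have {n4} {}n6 : #|vertex G| = 6 by lia.
have pair A : 1 < #|A| < 5 -> (n_inner A).*2 + 4 <= 3 * #|A|.
  move=> /andP[A1 A4]; have := cardsC A; have := e4 A1; have := cubic_handshake cG A.
  lia.
have edge_in A e : ends e \subset A -> 0 < n_inner A.
  by move=> eA; apply/card_gt0P; exists e; rewrite !inE.
have in_edge A : 0 < n_inner A -> exists e, ends e \subset A.
  by case/card_gt0P=> e; rewrite !inE /=; exists e.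
(* Removing the perfect matching [e0], [f], [g] leaves a 2-regular graph. *)
have /card_gt0P[e0 _] : 0 < #|edge G| by lia.
pose R := ~: ends e0; have cR := cardsC (ends e0); rewrite card_endsE in cR.
have cR4 : #|~: ends e0| = 4 by lia.
have n0 := edge_in _ _ (subxx (ends e0)).
have p0 := pair (ends e0); rewrite card_endsE in p0.
have h0 := cubic_handshake cG (ends e0); rewrite card_endsE in h0.
have hR := cubic_handshake cG R; rewrite /n_boundary boundaryC -/(n_boundary (ends e0)) in hR.
(* [e0] is the only edge between its ends, so four edges leave them, and [R] induces [(12 - 4) / 2]
   edges. Three vertices induce at most two, so every vertex of [R] has inner degree at least 2, and
   exactly 2 by the degree sum 8. *)
have nR : n_inner R = 4 by rewrite /R in hR *; lia.
have dR1 a : a \in R -> 2 <= inner_degree R a.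
  move=> aR; have := n_inner_del aR; have := cardsD1 a R; rewrite aR.
  have := pair (R :\ a); rewrite -/R in cR4; lia.
have dR a : a \in R -> inner_degree R a = 2.
  move=> aR; apply/eqP; rewrite eqn_leq dR1 // andbT leqNgt; apply/negP=> d3.
  have : \sum_(v in R) (2 + (v == a)) <= \sum_(v in R) inner_degree R v.
    apply: leq_sum => v vR; case: eqP => [->|_]; first by rewrite addn1.
    by rewrite addn0 dR1.
  rewrite sum_inner_degree nR big_split sum_nat_const /= (bigD1 a) //= eqxx.
  rewrite -/R in cR4; lia.
have [f fR] : exists f, ends f \subset R by apply: in_edge; rewrite nR.
have [a [c [ac Ef]]] := endsP f.
have aR : a \in R by apply: (subsetP fR); rewrite Ef !inE eqxx.
have cR' : c \in R :\ a.
  by rewrite in_setD1 eq_sym ac; apply: (subsetP fR); rewrite Ef !inE eqxx orbT.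
have cR2 : c \in R by case/setD1P: cR'.
have lt : inner_degree (R :\ a) c < inner_degree R c.
  apply/proper_card/properP; split.
    apply/subsetP=> g; rewrite !inE => /andP[/= sf ->]; rewrite andbT.
    exact: subset_trans sf (subsetDl _ _).
  exists f; rewrite !inE /= -?/R.
    by rewrite fR Ef !inE eqxx orbT.
  apply/negP=> /andP[/subsetP/(_ a)]; rewrite Ef !inE eqxx /= => /(_ isT).
  by [].
(* Of the four edges in [R], two are lost with [a] and at most one more with [c]. *)
have [g gW] : exists g, ends g \subset R :\ a :\ c.
  apply: in_edge; have := n_inner_del aR; have := n_inner_del cR'.
  by rewrite dR // nR; rewrite dR // in lt; lia.
have cW := cardsD1 c (R :\ a); have cRa := cardsD1 a R; rewrite cR' aR in cW cRa.
have Eg : ends g = R :\ a :\ c.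
  apply/eqP; rewrite eqEcard gW card_endsE; rewrite -/R in cR4; lia.
apply: (two_regular_dominating (F := ~: [set e0; f; g])) => //.
apply/forall_inP=> v _; rewrite /degree.
suff [b Eb] : exists b, [set e in [set e0; f; g] | v \in ends e] = [set b].
  have := cubic_degree cG v.
  rewrite /degree -(cardsID [set e0; f; g]) -[X in X + _ = _]/#|_|.
  have -> : [set e in edges (whole G) | v \in ends e] :&: [set e0; f; g] = [set b].
    by rewrite -Eb; apply/setP=> e; rewrite !inE andbC.
  rewrite cards1 add1n => -[] <-; apply/eqP/eq_card => e; rewrite !inE.
  by [].
have m0 : (v \in ends e0) = (v \notin R) by rewrite !inE negbK.
have mf : (v \in ends f) = (v == a) || (v == c) by rewrite Ef !inE.
have mg : (v \in ends g) = [&& v != c, v != a & v \in R] by rewrite Eg !in_setD1.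
have mset b : b \in [set e0; f; g] ->
    (forall e, e \in [set e0; f; g] -> (v \in ends e) = (e == b)) ->
    [set e in [set e0; f; g] | v \in ends e] = [set b].
  move=> bF hb; apply/setP=> e; rewrite inE [RHS]inE.
  have [eF|eF] := boolP (e \in [set e0; f; g]); first exact: hb.
  by apply/esym/eqP=> Eb; rewrite Eb bF in eF.
have n0f : e0 != f.
  by apply/eqP=> E; have := aR; rewrite inE E Ef !inE eqxx.
have nfg : f != g.
  by apply/eqP=> E; have := Eg; rewrite -E Ef => /setP/(_ c); rewrite !inE eqxx orbT.
have n0g : e0 != g.
  apply/eqP=> E; have := card_endsE g; rewrite -E => c2.
  have /card_gt0P[z z0] : 0 < #|ends e0| by rewrite c2.
  have := subsetP gW z; rewrite -E z0 => /(_ isT); rewrite !in_setD1 !inE z0.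
  by rewrite !andbF.
have eF e : e \in [set e0; f; g] -> [\/ e = e0, e = f | e = g].
  by rewrite !inE -orbA => /or3P[]/eqP->; [apply: Or31|apply: Or32|apply: Or33].
have [vR|vR] := boolP (v \in R); last first.
  have va : v != a by apply: contraNneq vR => ->.
  have vc : v != c by apply: contraNneq vR => ->.
  exists e0; apply: mset; first by rewrite !inE eqxx.
  move=> e /eF[]->; rewrite ?m0 ?mf ?mg ?(negPf va) ?(negPf vc) ?(negPf vR) ?andbF ?eqxx //.
    by rewrite eq_sym (negPf n0f).
  by rewrite eq_sym (negPf n0g).
have [vac|vac] := boolP ((v == a) || (v == c)).
  exists f; apply: mset; first by rewrite !inE eqxx orbT.
  move=> e /eF[]->; rewrite ?m0 ?mf ?mg ?vR ?vac ?eqxx //=.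
    by rewrite (negPf n0f).
  by rewrite [g == f]eq_sym (negPf nfg) andbT -negb_or orbC vac.
exists g; apply: mset; first by rewrite !inE eqxx orbT.
move=> e /eF[]->; rewrite ?m0 ?mf ?mg ?vR ?(negPf vac) ?eqxx //=.
- by rewrite (negPf n0g).
- by rewrite (negPf nfg).
by rewrite andbT -negb_or orbC vac.
Qed.

End NoTwoDisjointCycles.

(** * Contracting the triangles *)

Section Quotient.
Variables (G : mgraph) (V : finType) (f : vertex G -> V).

Definition quot_edge : finType := {e : edge G | #|f @: ends e| == 2}.
Definition quot_ends (e : quot_edge) : {set V} := f @: ends (val e).
Definition quot : mgraph := MGraph (fun e : quot_edge => valP e : #|quot_ends e| == 2).

Lemma quot_endsE (e : edge quot) x y : ends (val e) = [set x; y] -> ends e = [set f x; f y].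
Proof. by move=> E; rewrite /= /quot_ends E imsetU1 imset_set1. Qed.

Lemma mem_quot_ends (e : edge quot) x : x \in ends (val e) -> f x \in ends e.
Proof. exact: imset_f. Qed.

(** Edges that disappear have both ends in one fibre and never cross a preimage, so cuts of the
    quotient are cuts of [G]. *)
Lemma boundary_quot (A : {set V}) :
  boundary (whole G) (f @^-1: A) = val @: boundary (whole quot) A.
Proof.
apply/setP=> e; apply/boundaryP/imsetP => [[_ [x [y [xA yA E]]]]|[e' e'A ->]].
  rewrite !inE in xA yA.
  have c2 : #|f @: ends e| == 2.
    rewrite E imsetU1 imset_set1 cards2; have [fxy|//] := eqVneq (f x) (f y).
    by rewrite -fxy xA in yA.
  exists (exist _ e c2) => //; apply/boundaryP; split; first by rewrite inE.
  by exists (f x), (f y); split=> //; exact: quot_endsE.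
split; first by rewrite inE.
have [x [y [xy E]]] := endsP (val e'); have E' := quot_endsE E.
case/boundaryP: e'A => _ [a [b [aA bA Eab]]].
have : (a \in [set f x; f y]) /\ (b \in [set f x; f y]).
  by rewrite -E' Eab !inE !eqxx orbT.
have ab : a != b by apply: contraNneq bA => <-.
case=> /set2P[] ? /set2P[] ?; subst; rewrite ?eqxx // in ab *.
  by exists x, y; rewrite !inE.
by exists y, x; rewrite setUC !inE.
Qed.

Lemma n_boundary_quot (A : {set V}) : n_boundary (G := quot) A = n_boundary (f @^-1: A).
Proof. by rewrite /n_boundary boundary_quot card_imset //; exact: val_inj. Qed.

End Quotient.

(** Turns degrees of the quotient into cuts, which [n_boundary_quot] pulls back. *)
Lemma degree_n_boundary (G : mgraph) (v : vertex G) : degree (whole G) v = n_boundary [set v].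
Proof.
apply: eq_card => e; rewrite inE [RHS]inE; congr (_ && _).
apply/idP/cards1P => [ve|[x E]].
  by exists v; apply/setIidPr; rewrite sub1set.
have : x \in ends e :&: [set v] by rewrite E inE.
by rewrite !inE => /andP[xe /eqP<-].
Qed.

(** * Small cuts when the matching contraction is 4-connected *)

Section Contraction.
Variables (G : mgraph) (M : {set edge G}).
Hypothesis cG : cubic G.
Hypothesis pM : perfect_matching M.
Hypothesis k4 : k_connected 4 (contract M).
Implicit Types (e : edge G) (x y v : vertex G) (A Z : {set vertex G}).

Lemma covered v : exists e, (e \in M) && (v \in ends e).
Proof. by case/andP: pM => _ /forallP/(_ v)/exists_inP[e eM ve]; exists e; rewrite eM. Qed.

Definition mu v := xchoose (covered v).

Lemma muM v : mu v \in M. Proof. by case/andP: (xchooseP (covered v)). Qed.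
Lemma mu_end v : v \in ends (mu v). Proof. by case/andP: (xchooseP (covered v)). Qed.

Lemma muE v e : (e \in M) && (v \in ends e) = (e == mu v).
Proof.
apply/andP/eqP=> [[eM ve]|->]; last by rewrite muM mu_end.
apply/eqP/negPn/negP=> ne; case/andP: pM => /forall_inP/(_ e eM)/forall_inP/(_ _ (muM v)).
by rewrite ne => /pred0P/(_ v); rewrite /= ve mu_end.
Qed.

Lemma mate_ex v : exists w, (w != v) && (ends (mu v) == [set v; w]).
Proof. by have [w wv E] := ends_other (mu_end v); exists w; rewrite wv E eqxx. Qed.

Definition mate v := xchoose (mate_ex v).

Lemma mate_neq v : mate v != v. Proof. by case/andP: (xchooseP (mate_ex v)). Qed.
Lemma ends_mu v : ends (mu v) = [set v; mate v].
Proof. by case/andP: (xchooseP (mate_ex v)) => _ /eqP. Qed.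

Lemma mu_mate v : mu (mate v) = mu v.
Proof. by apply/esym/eqP; rewrite -muE muM ends_mu !inE eqxx orbT. Qed.

Lemma mu_eq v w : mu v = mu w -> w = v \/ w = mate v.
Proof. by move=> E; have := mu_end w; rewrite -E ends_mu => /set2P. Qed.

Lemma mateK : involutive mate.
Proof.
move=> v; have := mu_end v; rewrite -mu_mate ends_mu => /set2P[] E //.
by have := mate_neq v; rewrite -E eqxx.
Qed.

Lemma proj_mu x y : contract_proj M x = contract_proj M y <-> mu x = mu y.
Proof. exact: contract_proj_eq muE x y. Qed.

Lemma degree_M v : degree (spanning M) v = 1.
Proof.
rewrite /degree -(cards1 (mu v)); apply: eq_card => e; rewrite [LHS]inE [RHS]inE.
exact: muE.
Qed.

Lemma degree_nM v : degree (spanning (~: M)) v = 2.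
Proof.
have := cubic_degree cG v; have := degree_M v; rewrite /degree /= => d1.
rewrite -(cardsID M); have -> : [set e in [set: edge G] | v \in ends e] :&: M =
    [set e in M | v \in ends e] by apply/setP=> e; rewrite !inE andbC.
rewrite d1 add1n => -[] <-; apply: eq_card => e.
by rewrite !inE.
Qed.

Notation bM A := #|boundary (spanning M) A|.
Notation bN A := #|boundary (spanning (~: M)) A|.

Lemma card_M A : #|A| = (#|inner (spanning M) A|).*2 + bM A.
Proof.
have := handshake (spanning M) A; under eq_bigr => v _ do rewrite degree_M.
by rewrite sum_nat_const muln1.
Qed.

(** The complement of a perfect matching in a cubic graph is 2-regular, and its cuts are even. *)
Lemma bN_even A : ~~ odd (bN A).
Proof.
have := handshake (spanning (~: M)) A; under eq_bigr => v _ do rewrite degree_nM.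
by rewrite sum_nat_const => /(congr1 odd); rewrite oddD odd_double oddM andbF => /= <-.
Qed.

Lemma n_boundaryE A : n_boundary A = bM A + bN A.
Proof.
rewrite /n_boundary -(cardsID M); congr (_ + _); apply: eq_card => e; rewrite !inE.
  by rewrite andbC.
by [].
Qed.

(** The contraction has at least five vertices, and each comes from its own matching edge. *)
Lemma card_vertex_ge10 : 10 <= #|vertex G|.
Proof.
have : #|vertex (contract M)| <= #|M|.
  have rep (c : vertex (contract M)) : exists v, contract_proj M v == c.
    by have [v ->] := contract_surj c; exists v.
  have repE c := eqP (xchooseP (rep c)).
  have inj : injective (fun c => mu (xchoose (rep c))).
    by move=> c d /proj_mu; rewrite !repE.
  rewrite -(card_codom inj); apply/subset_leq_card/subsetP=> e /codomP[c ->].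
  exact: muM.
have := card_M setT; rewrite (boundary_verts (spanning M)) (inner_verts (spanning M)).
by rewrite cards0 addn0 cardsT -[edges _]/M; case: k4 => + _; lia.
Qed.

(* If [Z] meets every edge leaving [A], the classes of [Z] separate the classes
   inside [A] from those outside, so one side lies in the classes of [Z]. *)
Lemma separate A Z : #|Z| <= 3 ->
  (forall e x y, ends e = [set x; y] -> x \in A -> y \notin A -> (x \in Z) || (y \in Z)) ->
  (forall v, v \in A -> (v \in Z) || (mate v \in Z)) \/
  (forall v, v \notin A -> (v \in Z) || (mate v \in Z)).
Proof.
move=> Z3 sep; pose X := contract_proj M @: Z.
have inX v : (contract_proj M v \in X) = (v \in Z) || (mate v \in Z).
  apply/imsetP/orP=> [[z zZ /proj_mu/mu_eq[] E]|[vZ|vZ]].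
  - by left; rewrite -E.
  - by right; rewrite -E.
  - by exists v.
  by exists (mate v) => //; apply/proj_mu; rewrite mu_mate.
have X4 : #|X| < 4 by apply: leq_ltn_trans (leq_imset_card _ _) _.
have [/forall_inP ?|] := boolP [forall v in A, (v \in Z) || (mate v \in Z)]; first by left.
case/forall_inPn=> a aA; rewrite -inX => aX.
right=> b bA; rewrite -inX; apply: contraNT bA => bX.
(* A matching edge that avoids [Z] does not cross [A], so a class outside [X] lies on one side of
   [A]. *)
have same v w : v \in A -> contract_proj M v = contract_proj M w ->
    contract_proj M v \notin X -> w \in A.
  move=> vA /proj_mu/mu_eq[->//|Ew]; rewrite inX negb_or; case/andP=> vZ mZ.
  apply: contraNT mZ => wA; have := sep _ v (mate v) (ends_mu v) vA.
  by rewrite -Ew (negPf vZ) => /(_ wA).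
pose P := [set c in contract_proj M @: A | c \notin X].
(* The classes of [A] outside [X] are closed under adjacency in the contraction minus at most three
   vertices, which is connected. *)
have EP : P = verts (@del_verts (contract M) X).
  apply: (@connected_closed (contract M)); first by case: k4 => _; apply.
  - by apply/subsetP=> c; rewrite !inE => /andP[].
  - by apply/set0Pn; exists (contract_proj M a); rewrite inE imset_f.
  move=> c d /setIdP[/imsetP[v vA ->] vX] cd.
  have [_] := adj_verts cd; rewrite inE => dX; rewrite inE dX andbT.
  case/adjP: cd => -[e e2] _; rewrite /= /contract_ends /= => Ee.
  have dE : d \in contract_proj M @: ends e by rewrite Ee !inE eqxx orbT.
  have cE : contract_proj M v \in contract_proj M @: ends e by rewrite Ee !inE eqxx.
  case/imsetP: dE dX => y ye -> yX; case/imsetP: cE => x xe vx.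
  have xA : x \in A by exact: same vx vX.
  have [<-|xy] := eqVneq x y; first exact: imset_f.
  apply/imset_f; apply: contraLR vX => yA; rewrite vx negbK.
  have := sep e x y (ends_pair xe ye xy) xA yA; rewrite !inX in yX *.
  by rewrite orbC => /orP[yZ|->//]; rewrite yZ in yX.
have : contract_proj M b \in P by rewrite EP inE.
by case/setIdP=> /imsetP[v vA bv] _; apply: (same v) => //; rewrite -bv.
Qed.

Definition matched_out A := [forall v in A, mate v \notin A].

Lemma bM_mate A : bM A = #|[set v in A | mate v \notin A]|.
Proof.
have inj : {in [set v in A | mate v \notin A] &, injective mu}.
  move=> v w /setIdP[vA mv] /setIdP[wA mw] /mu_eq[->//|E].
  by rewrite -E wA in mv.
rewrite -(card_in_imset inj); apply: eq_card => e; apply/boundaryP/imsetP.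
  case=> eM [x [y [xA yA E]]]; exists x; last first.
    by apply/eqP; rewrite -muE E !inE eqxx andbT.
  have Ex : e = mu x by apply/eqP; rewrite -muE E !inE eqxx andbT.
  rewrite inE xA; have : y \in ends (mu x) by rewrite -Ex E !inE eqxx orbT.
  by rewrite ends_mu => /set2P[] Ey; [rewrite Ey xA in yA|rewrite -Ey].
by case=> v /setIdP[vA mv] ->; split; [exact: muM|exists v, (mate v); rewrite ends_mu].
Qed.

Definition crossing A := [set v in A | [exists e in boundary (spanning (~: M)) A, v \in ends e]].

(** A boundary edge has a single end in [A], so choosing a crossing edge at each crossing vertex is
    injective. *)
Lemma card_crossing A : #|crossing A| <= bN A.
Proof.
have ex v : v \in crossing A -> exists e, (e \in boundary (spanning (~: M)) A) && (v \in ends e).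
  by case/setIdP=> _ /exists_inP[e eb ve]; exists e; rewrite eb.
pose h v := if [pick e in boundary (spanning (~: M)) A | v \in ends e] is Some e then e else mu v.
have hP v : v \in crossing A -> (h v \in boundary (spanning (~: M)) A) && (v \in ends (h v)).
  move/ex=> [e ee]; rewrite /h; case: pickP => [//|/(_ e)]; by rewrite ee.
have inj : {in crossing A &, injective h}.
  move=> v w vc wc E; have /andP[hb hv] := hP _ vc; have /andP[_ hw] := hP _ wc.
  have [vA _] := setIdP vc; have [wA _] := setIdP wc.
  move: hb; rewrite inE => /andP[_ /cards1P[z Ez]].
  have : v \in ends (h v) :&: A by rewrite inE hv.
  have : w \in ends (h v) :&: A by rewrite inE E hw.
  by rewrite Ez !inE => /eqP-> /eqP->.
rewrite -(card_in_imset inj); apply/subset_leq_card/subsetP=> e /imsetP[v vc ->].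
by case/andP: (hP _ vc).
Qed.

Lemma crossing_cover A e x y : ends e = [set x; y] -> x \in A -> y \notin A ->
  (mate x \notin A) || (x \in crossing A).
Proof.
move=> E xA yA; have [eM|eM] := boolP (e \in M); apply/orP; [left|right].
  have Ex : e = mu x by apply/eqP; rewrite -muE eM E !inE eqxx.
  have : y \in ends (mu x) by rewrite -Ex E !inE eqxx orbT.
  by rewrite ends_mu => /set2P[] Ey; [rewrite Ey xA in yA|rewrite -Ey].
rewrite inE xA; apply/exists_inP; exists e; last by rewrite E !inE eqxx.
by apply/boundaryP; split; [rewrite inE|exists x, y].
Qed.

Lemma matched_outPn A : ~~ matched_out A -> exists v, v \in A /\ mate v \in A.
Proof. by case/forall_inPn=> v vA; rewrite negbK; exists v. Qed.

(** [Z] consists of the ends in [A] of the cut edges, at most three. It misses a matching edge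
    outside [A], so by [separate] every vertex of [A] has itself or its mate in [Z]; mates of
    vertices of [Y] lie outside [A] and contribute nothing. *)
Lemma bN_bound A : n_boundary A <= 3 -> ~~ matched_out (~: A) -> #|A| <= (bN A).*2 + bM A.
Proof.
move=> b3 /matched_outPn[b []]; rewrite !inE => bA mbA.
pose Y := [set v in A | mate v \notin A]; pose Z := Y :|: crossing A.
have ZA z : z \in Z -> z \in A by case/setUP=> /setIdP[].
have Z3 : #|Z| <= 3.
  apply: leq_trans (leq_card_setU _ _) _; rewrite -bM_mate.
  by have := card_crossing A; move: b3; rewrite n_boundaryE; lia.
have [|hA|hA] := @separate A Z Z3.
- move=> e x y E xA yA; rewrite in_setU in_set xA /=.
  by rewrite (crossing_cover E xA yA).
- rewrite -addnn -addnA addnC; apply: (@leq_trans #|Y :|: crossing A :|: mate @: crossing A|).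
    apply/subset_leq_card/subsetP=> v vA; have /orP[vZ|] := hA v vA.
      by apply/setUP; left.
    case/setUP=> [/setIdP[_]|mc]; first by rewrite mateK vA.
    by apply/setUP; right; apply/imsetP; exists (mate v); rewrite ?mateK.
  apply: leq_trans (leq_card_setU _ _) _; rewrite (card_imset _ (inv_inj mateK)).
  have := (leq_card_setU Y (crossing A)).1; rewrite -bM_mate.
  by have := card_crossing A; lia.
by case/orP: (hA b bA) => /ZA; rewrite ?(negPf bA) ?(negPf mbA).
Qed.

(** Otherwise [bN_bound] holds on both sides, giving [10 <= 2 * (2 * bN A + bM A)] with [bN A] even
    and [bN A + bM A <= 3]. This leaves two cut edges outside [M], one in [M], and five vertices on
    each side. *)
Lemma boundary_matched_out A : n_boundary A <= 3 -> matched_out A || matched_out (~: A).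
Proof.
move=> b3; apply: contraT; rewrite negb_or => /andP[nA nA'].
have h := bN_bound b3 nA'.
have h' : #|~: A| <= (bN A).*2 + bM A.
  rewrite -!(boundaryC _ A); apply: bN_bound; last by rewrite setCK.
  by rewrite /n_boundary boundaryC.
have n10 := card_vertex_ge10; have cA := cardsC A.
have ev := bN_even A; have bE := n_boundaryE A.
(* This extremal case is excluded by a separator with one vertex on each side
   of the two crossing edges outside [M]. *)
have [N2 [M1 [A5 A5']]] : bN A = 2 /\ bM A = 1 /\ #|A| = 5 /\ #|~: A| = 5 by lia.
have /cards2P[e1 [e2 [e12 Eb]]] := introT eqP N2.
have /boundaryP[e1N [a1 [b1 [a1A b1A E1]]]] : e1 \in boundary (spanning (~: M)) A.
  by rewrite Eb !inE eqxx.
have /boundaryP[e2N [a2 [b2 [a2A b2A E2]]]] : e2 \in boundary (spanning (~: M)) A.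
  by rewrite Eb !inE eqxx orbT.
pose Y := [set v in A | mate v \notin A].
have Y1 : #|Y| = 1 by rewrite -bM_mate.
have card3 x y z : #|[set x; y; z : vertex G]| <= 3.
  by apply: leq_trans (leq_card_setU _ _) _; rewrite cards2 cards1; case: (_ != _).
have [|e x y E xA yA|hA|hA] := @separate A (Y :|: [set a1; b2]).
- by apply: leq_trans (leq_card_setU _ _) _; rewrite Y1 cards2; case: (_ != _).
- have [eM|eM] := boolP (e \in M).
    have Ex : e = mu x by apply/eqP; rewrite -muE eM E !inE eqxx.
    have ye : y \in ends (mu x) by rewrite -Ex E !inE eqxx orbT.
    have Ey : y = mate x by move: ye; rewrite ends_mu => /set2P[] // Ey; rewrite Ey xA in yA.
    by apply/orP; left; apply/setUP; left; rewrite inE xA -Ey.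
  have : e \in boundary (spanning (~: M)) A.
    by apply/boundaryP; split; [rewrite inE|exists x, y].
  rewrite Eb => /set2P[] Ee; rewrite Ee ?E1 ?E2 in E.
    have : a1 \in [set x; y] by rewrite -E !inE eqxx.
    case/set2P=> Ea; first by rewrite !inE -Ea eqxx !orbT.
    by rewrite -Ea a1A in yA.
  have : b2 \in [set x; y] by rewrite -E !inE eqxx orbT.
  case/set2P=> Eb2; last by rewrite !inE -Eb2 eqxx !orbT.
  by rewrite Eb2 xA in b2A.
(* Only four of the five vertices of [A] can be covered: the one in [Y], [a1], and the mates of [a1]
   and [b2]. The other side is symmetric. *)
- have : #|A| <= #|Y :|: [set a1; mate a1; mate b2]|.
    apply/subset_leq_card/subsetP=> v vA; rewrite !in_setU !in_set1.
    case/orP: (hA v vA); rewrite !in_setU !in_set1.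
      case/or3P=> [->//|/eqP->|/eqP Ev]; rewrite ?eqxx ?orbT //.
      by rewrite -Ev vA in b2A.
    case/or3P=> [/setIdP[_]|/eqP<-|/eqP<-]; rewrite ?mateK ?eqxx ?orbT ?vA //.
  by have := (leq_card_setU Y [set a1; mate a1; mate b2]).1;
    have := card3 a1 (mate a1) (mate b2); lia.
have : #|~: A| <= #|mate @: Y :|: [set b2; mate b2; mate a1]|.
  apply/subset_leq_card/subsetP=> v; rewrite inE => vA; rewrite !in_setU !in_set1.
  case/orP: (hA v vA); rewrite !in_setU !in_set1.
    case/or3P=> [/setIdP[]|/eqP Ev|/eqP->]; rewrite ?eqxx ?orbT ?(negPf vA) //.
    by rewrite Ev a1A in vA.
  case/or3P=> [mY|/eqP<-|/eqP<-]; rewrite ?mateK ?eqxx ?orbT //.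
  by apply/orP; left; apply/imsetP; exists (mate v); rewrite ?mateK.
have := (leq_card_setU (mate @: Y) [set b2; mate b2; mate a1]).1.
by rewrite (card_imset _ (inv_inj mateK)); have := card3 b2 (mate b2) (mate a1); lia.
Qed.

Lemma bM_matched_out A : matched_out A -> bM A = #|A|.
Proof.
move/forall_inP=> oA; rewrite bM_mate; apply: eq_card => v; rewrite inE.
exact/andb_idr/oA.
Qed.

Lemma matched_out_card A : n_boundary A <= 3 -> matched_out A -> #|A| <= 3 /\ #|A| != 2.
Proof.
move=> b3 oA; have cM := bM_matched_out oA; have bE := n_boundaryE A; split; first by lia.
apply/eqP=> A2; have ev := bN_even A.
have hA := cubic_handshake cG A.
have [u uA] : exists u, u \in A by apply/card_gt0P; rewrite A2.
have muA : mate u \notin A by move/forall_inP: oA; apply.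
(* [A] would be a digon; adding the mate of one of its vertices gives a cut of
   size at most three neither side of which is matched out. *)
pose B := mate u |: A; have cB : #|B| = 3 by rewrite cardsU1 muA A2.
have lt : n_inner A < n_inner B.
  apply/proper_card/properP; split.
    apply/subsetP=> e; rewrite !inE /= => sA; exact: subset_trans sA (subsetUr _ _).
  exists (mu u); rewrite !inE /= ends_mu.
    by apply/subsetP=> z /set2P[]->; rewrite !inE ?eqxx ?uA ?orbT.
  by apply: contraNN muA => /subsetP; apply; rewrite !inE eqxx orbT.
have hB := cubic_handshake cG B; have b3' : n_boundary B <= 3 by lia.
have := boundary_matched_out b3'; case/orP=> oB.
  move/forall_inP/(_ u): oB; rewrite !inE uA eqxx orbT => /(_ isT); by [].
have := bM_matched_out oB; rewrite boundaryC => cM'.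
have := n_boundaryE B; have := cardsC B; have := card_vertex_ge10; lia.
Qed.

(** The matching edges of the three vertices already use up the three cut edges, so the set induces
    three edges; by [tri_pair] these form a triangle. *)
Definition tri A := [&& #|A| == 3, n_boundary A <= 3 & matched_out A].

Lemma small_cut A : n_boundary A <= 3 -> [\/ #|A| <= 1, #|~: A| <= 1, tri A | tri (~: A)].
Proof.
move=> b3; have b3' : n_boundary (~: A) <= 3 by rewrite /n_boundary boundaryC.
case/orP: (boundary_matched_out b3) => oA.
  have [A3 A2] := matched_out_card b3 oA; have [le1|gt1] := leqP #|A| 1.
    exact: Or41.
  by apply: Or43; rewrite /tri b3 oA !andbT; lia.
have [A3 A2] := matched_out_card b3' oA; have [le1|gt1] := leqP #|~: A| 1.
  exact: Or42.
by apply: Or44; rewrite /tri b3' oA !andbT; lia.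
Qed.

Lemma tri_card A : tri A -> #|A| = 3. Proof. by case/and3P=> /eqP. Qed.

Lemma tri_out A v : tri A -> v \in A -> mate v \notin A.
Proof. by case/and3P=> _ _ /forall_inP; apply. Qed.

Lemma tri_n_boundary A : tri A -> n_boundary A = 3 /\ boundary (whole G) A \subset M.
Proof.
case/and3P=> /eqP A3 b3 oA; have := n_boundaryE A; rewrite (bM_matched_out oA) A3 => bE.
split; first by lia.
have N0 : bN A = 0 by lia.
apply/subsetP=> e /boundaryP[_ h]; apply: contraT => eM.
have : e \in boundary (spanning (~: M)) A by apply/boundaryP; rewrite inE.
by move/eqP: N0; rewrite cards_eq0 => /eqP->; rewrite inE.
Qed.

Lemma tri_boundary A x e : tri A -> x \in A -> x \in ends e -> ~~ (ends e \subset A) -> e = mu x.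
Proof.
move=> tA xA xe sA; apply/eqP; rewrite -muE xe andbT.
have [_ /subsetP] := tri_n_boundary tA; apply; apply/boundaryP; split; first by rewrite inE.
have [y yx E] := ends_other xe; exists x, y; split=> //; apply: contraNN sA => yA.
by rewrite E; apply/subsetP=> z /set2P[]->.
Qed.

(** Every edge leaving the intersection [K] leaves [A] or [B], hence is in [M]. If [K] were proper,
    its cut would have at most two edges; [small_cut] then makes [K] a single vertex, whose cut has
    three. *)
Lemma tri_meet A B x : tri A -> tri B -> x \in A -> x \in B -> A = B.
Proof.
move=> tA tB xA xB; have [cA cB] := (tri_card tA, tri_card tB).
pose K := A :&: B; have [E|nK] := eqVneq K A.
  by apply/eqP; rewrite eqEcard cA cB andbT -E subsetIr.
have K3 : #|K| < 3 by rewrite -cA; apply: proper_card; rewrite properEneq nK subsetIl.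
have K0 : 0 < #|K| by apply/card_gt0P; exists x; rewrite inE xA.
have bN0 : bN K = 0.
  apply/eqP; rewrite cards_eq0; apply/eqP/setP=> e; rewrite [RHS]inE.
  apply/negP=> /boundaryP[eN [z [y [/setIP[zA zB] yK E]]]]; move: eN; rewrite inE.
  have ze : z \in ends e by rewrite E !inE eqxx.
  have ye : y \in ends e by rewrite E !inE eqxx orbT.
  move: yK; rewrite inE negb_and => /orP[] yN; rewrite (_ : e = mu z) ?muM //.
    by apply: tri_boundary tA zA ze _; apply: contraNN yN => /subsetP; apply.
  by apply: tri_boundary tB zB ze _; apply: contraNN yN => /subsetP; apply.
have hK := cubic_handshake cG K; have cK := card_M K; have bE := n_boundaryE K.
have n10 := card_vertex_ge10; have cK' := cardsC K.
have [||||] := @small_cut K; first by lia.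
- move=> K1; have /cards1P[z Ez] : #|K| == 1 by lia.
  by have := n_inner1 z; rewrite -Ez; lia.
- by lia.
- by move/tri_card; lia.
by move/tri_card; lia.
Qed.

(** * The quotient by the triangles *)

Definition tri_class v : {set vertex G} :=
  [set w | (w == v) || [exists A, [&& tri A, v \in A & w \in A]]].

Lemma tri_class_tri A v : tri A -> v \in A -> tri_class v = A.
Proof.
move=> tA vA; apply/setP=> w; rewrite inE; apply/orP/idP=> [[/eqP->//|]|wA].
  by case/existsP=> B /and3P[tB vB wB]; rewrite (tri_meet tA tB vA vB).
by right; apply/existsP; exists A; rewrite tA vA.
Qed.

Lemma tri_classP v : (exists A, tri A /\ v \in A) \/ tri_class v = [set v].
Proof.
have [/existsP[A /andP[tA vA]]|no] := boolP [exists A, tri A && (v \in A)].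
  by left; exists A.
right; apply/setP=> w; rewrite !inE; apply: orb_idr => /existsP[A /and3P[tA vA _]].
by case/negP: no; apply/existsP; exists A; rewrite tA.
Qed.

Lemma tri_class_eq v w : (tri_class v == tri_class w) = (w \in tri_class v).
Proof.
apply/eqP/idP=> [->|]; first by rewrite inE eqxx.
have [[A [tA vA]]|E] := tri_classP v; last by rewrite {1}E inE => /eqP->.
by rewrite (tri_class_tri tA vA) => wA; rewrite (tri_class_tri tA wA).
Qed.

Lemma n_boundary_tri_class v : n_boundary (tri_class v) = 3.
Proof.
have [[A [tA vA]]|->] := tri_classP v.
  by rewrite (tri_class_tri tA vA); case: (tri_n_boundary tA).
by have := cubic_handshake cG [set v]; rewrite n_inner1 cards1.
Qed.

Definition tri_vertex : finType := {B : {set vertex G} | B \in codom tri_class}.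
Definition tri_proj v : tri_vertex := exist _ (tri_class v) (codom_f tri_class v).

Lemma tri_proj_eq v w : (tri_proj v == tri_proj w) = (w \in tri_class v).
Proof. by rewrite -tri_class_eq -val_eqE. Qed.

Lemma tri_proj_surj c : exists v, c = tri_proj v.
Proof. by case: c => B BP; have /codomP[v E] := BP; exists v; apply: val_inj. Qed.

Definition tri_quot := quot tri_proj.

Lemma tri_quot_cubic : cubic tri_quot.
Proof.
apply/forall_inP=> c _; rewrite degree_n_boundary n_boundary_quot.
have [v ->] := tri_proj_surj c; rewrite -(n_boundary_tri_class v) (_ : _ @^-1: _ = tri_class v) //.
by apply/setP=> w; rewrite !inE eq_sym tri_proj_eq inE.
Qed.

(** A cut of size at most three pulls back to one of [G]. By [small_cut] one side has at most one
    vertex or is a triangle, and so projects to at most one vertex. *)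
Lemma tri_quot_essentially_4 : essentially_4 tri_quot.
Proof.
move=> A A1 A1'; rewrite n_boundary_quot ltnNge; apply/negP=> b3.
have bound (B : {set vertex tri_quot}) : 1 < #|B| ->
    ~ (#|tri_proj @^-1: B| <= 1 \/ tri (tri_proj @^-1: B)).
  move=> B1 h; suff : #|B| <= 1 by lia.
  have /subset_leq_card le : B \subset tri_proj @: (tri_proj @^-1: B).
    apply/subsetP=> c cB; have [v Ev] := tri_proj_surj c; apply/imsetP; exists v => //.
    by rewrite inE -Ev.
  case: h => [h1|tB].
    exact: leq_trans le (leq_trans (leq_imset_card _ _) h1).
  have /card_gt0P[v vB] : 0 < #|tri_proj @^-1: B| by rewrite (tri_card tB).
  rewrite -(cards1 (tri_proj v)); apply: leq_trans le _; apply/subset_leq_card/subsetP=> c.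
  case/imsetP=> w wB ->; rewrite inE eq_sym tri_proj_eq (tri_class_tri tB vB) //.
case: (small_cut b3) => h.
- by apply: bound A1 _; left.
- by apply: bound A1' _; rewrite preimsetC; left.
- by apply: bound A1 _; right.
by apply: bound A1' _; rewrite preimsetC; right.
Qed.

Lemma tri_inner A v e : tri A -> v \in A -> v \in ends e -> (ends e \subset A) = (e != mu v).
Proof.
move=> tA vA ve; apply/idP/idP=> [sA|]; last by apply: contraNT => /(tri_boundary tA vA ve)->.
apply: contraNneq (tri_out tA vA) => E.
by apply: (subsetP sA); rewrite E ends_mu !inE eqxx orbT.
Qed.

Lemma tri_inner_degree A v : tri A -> v \in A -> inner_degree A v = 2.
Proof.
move=> tA vA; have := cubic_degree cG v; rewrite /degree.
rewrite (cardsD1 (mu v)) !inE mu_end add1n => -[] <-; apply: eq_card => e.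
rewrite !inE /=; have [ve|] := boolP (v \in ends e); last by rewrite !andbF.
by rewrite (tri_inner tA vA ve).
Qed.

(** Deleting the third vertex, of inner degree 2, leaves one of the three inner edges. *)
Lemma tri_pair A x y : tri A -> x \in A -> y \in A -> x != y -> n_inner [set x; y] = 1.
Proof.
move=> tA xA yA xy; have A3 := tri_card tA.
have [w wA] : exists w, w \in A :\: [set x; y].
  apply/card_gt0P; rewrite cardsD A3 (setIidPr _) ?cards2 ?xy //.
  by apply/subsetP=> z /set2P[]->.
have /setDP[wA' wxy] := wA.
have <- : A :\ w = [set x; y].
  apply/esym/eqP; rewrite eqEcard cards2 xy; have := cardsD1 w A; rewrite wA' A3 add1n => -[<-].
  rewrite andbT; apply/subsetP=> z zxy; rewrite in_setD1 (contraNneq _ wxy) => [|<-//].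
  by case/set2P: zxy => ->.
have := n_inner_del wA'; have := cubic_handshake cG A; rewrite (tri_inner_degree tA wA') A3.
by case: (tri_n_boundary tA) => -> _; lia.
Qed.

(** * Lifting a cycle of the quotient *)

Section Lift.
Variable C : subgraph tri_quot.
Hypothesis cC : is_cycle C.

Definition lift_edges : {set edge G} := [set val (e : quot_edge tri_proj) | e in edges C].

(* The sides of the triangles met by [C] that contain the corner at which [C]
   neither enters nor leaves. *)
Definition lift_sides : {set edge G} :=
  [set e | [&& [exists A, tri A && (ends e \subset A)],
    ends e \subset tri_proj @^-1: verts C & [exists z in ends e, mu z \notin lift_edges]]].

Lemma lift_proof : [forall e in lift_edges :|: lift_sides,
  ends e \subset tri_proj @^-1: verts C].
Proof.
apply/forall_inP=> e /setUP[/imsetP[e' e'C ->]|]; last by rewrite inE => /and3P[].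
apply/subsetP=> x xe; rewrite inE; apply: edge_vert e'C _; exact: mem_quot_ends.
Qed.

Definition lift : subgraph G := Subgraph lift_proof.

Lemma lift_edges_tri A e : tri A -> e \in lift_edges -> ~~ (ends e \subset A).
Proof.
move=> tA /imsetP[e' _ ->]; have [x [y [xy E]]] := endsP (val e').
apply/negP; rewrite E => sA; have := valP e'; rewrite E imsetU1 imset_set1 cards2.
have xA : x \in A by apply: (subsetP sA); rewrite !inE eqxx.
have -> : tri_proj x == tri_proj y.
  by rewrite tri_proj_eq (tri_class_tri tA xA); apply: (subsetP sA); rewrite !inE eqxx orbT.
by [].
Qed.

Lemma lift_edges_degree v : tri_proj v \in verts C ->
  #|[set e in lift_edges | [exists w in tri_class v, w \in ends e]]| = 2.
Proof.
move=> vC; rewrite -(cycle_degree cC vC) /degree -(card_imset _ val_inj).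
apply: eq_card => e; rewrite inE; apply/andP/imsetP.
  case=> /imsetP[e' e'C ->] /exists_inP[w wv we]; exists e' => //.
  rewrite inE e'C /= (_ : tri_proj v = tri_proj w); first exact: imset_f.
  by apply/eqP; rewrite tri_proj_eq.
case=> e'; rewrite inE => /andP[e'C /imsetP[w we /eqP vw]] ->; split; first exact: imset_f.
by apply/exists_inP; exists w; rewrite // -tri_proj_eq.
Qed.

Lemma lift_edges_tri_mu A v e : tri A -> v \in A -> e \in lift_edges -> v \in ends e -> e = mu v.
Proof. by move=> tA vA eF ve; exact: tri_boundary tA vA ve (lift_edges_tri tA eF). Qed.

(** [C] has two edges at the contracted triangle, each the matching edge of a different corner; the
    third corner [z] is bypassed. *)
Lemma tri_bypass A v : tri A -> v \in A -> tri_proj v \in verts C ->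
  exists2 z, z \in A & forall w, w \in A -> (mu w \in lift_edges) = (w != z).
Proof.
move=> tA vA vC; pose W := [set w in A | mu w \in lift_edges].
have inj : {in W &, injective mu}.
  move=> w w' /setIdP[wA _] /setIdP[wA' _] /mu_eq[->//|E].
  by have := tri_out tA wA; rewrite -E wA'.
have W2 : #|W| = 2.
  rewrite -(lift_edges_degree vC) -(card_in_imset inj); apply: eq_card => e.
  rewrite (tri_class_tri tA vA) inE; apply/imsetP/andP=> [[w /setIdP[wA wF] ->]|].
    by split=> //; apply/exists_inP; exists w => //; exact: mu_end.
  case=> eF /exists_inP[w wA we]; have E := lift_edges_tri_mu tA wA eF we.
  by exists w; rewrite // inE wA -E.
have /cards1P[z Ez] : #|A :\: W| == 1.
  rewrite cardsD (tri_card tA) (setIidPr _) ?W2 //.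
  by apply/subsetP=> w /setIdP[].
have /setDP[zA _] : z \in A :\: W by rewrite Ez inE.
exists z => // w wA; have : (w \in A :\: W) = (w == z) by rewrite Ez inE.
by rewrite in_setD in_set wA andbT /= => <-; rewrite negbK.
Qed.

Lemma tri_side A v : tri A -> v \in A -> tri_proj v \in verts C ->
  A \subset tri_proj @^-1: verts C.
Proof.
move=> tA vA vC; apply/subsetP=> w wA; rewrite inE (_ : tri_proj w = tri_proj v) //.
by apply/eqP; rewrite tri_proj_eq (tri_class_tri tA wA).
Qed.

Lemma lift_sidesP A v z e : tri A -> v \in A -> tri_proj v \in verts C -> z \in A ->
  (forall w, w \in A -> (mu w \in lift_edges) = (w != z)) -> v \in ends e ->
  (e \in lift_sides) = (ends e \subset A) && (z \in ends e).
Proof.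
move=> tA vA vC zA zP ve; rewrite inE; apply/and3P/andP.
  case=> /existsP[B /andP[tB sB]] _ /exists_inP[w we wF].
  have AB := tri_meet tA tB vA (subsetP sB _ ve); rewrite -AB in sB; split=> //.
  by move: wF; rewrite zP ?(subsetP sB) // negbK => /eqP<-.
case=> sA ze; split; first by apply/existsP; exists A; rewrite tA.
  exact: subset_trans sA (tri_side tA vA vC).
by apply/exists_inP; exists z => //; rewrite zP // eqxx.
Qed.

(** Outside the triangles the incident edges are those of [C]. In a triangle the bypassed corner has
    its two sides, and each other corner has its matching edge and the side to the bypassed one. *)
Lemma lift_degree v : tri_proj v \in verts C -> degree lift v = 2.
Proof.
move=> vC; have [[A [tA vA]]|Ev] := tri_classP v; last first.
  rewrite -(lift_edges_degree vC) /degree Ev; apply: eq_card => e; rewrite inE [RHS]inE.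
  rewrite in_setU; have -> : [exists w in [set v], w \in ends e] = (v \in ends e).
    by apply/exists_inP/idP=> [[w /set1P->]|ve] //; exists v; rewrite ?inE.
  case: (e \in lift_edges) => //=; apply: contraTF isT => /andP[]; rewrite inE.
  case/and3P=> /existsP[A /andP[tA sA]] _ _ ve.
  have := tri_card tA; rewrite -(tri_class_tri tA (subsetP sA _ ve)) Ev cards1 //.
have [z zA zP] := tri_bypass tA vA vC.
have sP e ve := @lift_sidesP A v z e tA vA vC zA zP ve.
have atE (X : {set edge G}) w e : (e \in [set g in X | w \in ends g]) = (e \in X) && (w \in ends e).
  by rewrite inE.
have -> : degree lift v = #|[set e in lift_sides | v \in ends e]| + (mu v \in lift_edges).
  rewrite /degree -[edges lift]/(lift_edges :|: lift_sides) (cardsD1 (mu v)) addnC; congr (_ + _).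
    apply: eq_card => e; rewrite in_setD1 !atE in_setU.
    have [ve|] := boolP (v \in ends e); last by rewrite !andbF.
    rewrite !andbT sP // (tri_inner tA vA ve); case: eqP => //= ne.
    by case: (boolP (e \in lift_edges)) => // /(lift_edges_tri_mu tA vA)/(_ ve).
  rewrite atE in_setU sP ?mu_end // (tri_inner tA vA (mu_end v)) eqxx /=.
  by rewrite orbF andbT.
rewrite zP //; have [->|vz] := eqVneq v z.
  have zC : tri_proj z \in verts C by move/subsetP: (tri_side tA vA vC) => /(_ z zA); rewrite inE.
  rewrite addn0 -(tri_inner_degree tA zA); apply: eq_card => e; rewrite !atE.
  have [ze|] := boolP (z \in ends e); last by rewrite !andbF.
  by rewrite (lift_sidesP tA zA zC zA zP ze) ze !inE /= !andbT.
rewrite addn1 -(tri_pair tA vA zA vz); congr _.+1; apply: eq_card => e.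
rewrite atE [RHS]inE in_setT /=; apply/andP/idP=> [[eS ve]|sv].
  by move: eS; rewrite sP // => /andP[_ ze]; rewrite (ends_pair ve ze vz).
have Ee : ends e = [set v; z] by apply/eqP; rewrite eqEcard sv card_endsE cards2 vz.
have ve : v \in ends e by rewrite Ee !inE eqxx.
split=> //; rewrite sP // Ee !inE eqxx orbT andbT.
by apply/subsetP=> w /set2P[]->.
Qed.

(** Within a triangle, every corner is joined to the bypassed corner by a side in the lift. *)
Lemma lift_fiber x y : tri_proj x \in verts C -> tri_proj y = tri_proj x ->
  connect (adj lift) x y.
Proof.
move=> xC /esym/eqP; rewrite tri_proj_eq; have [[A [tA xA]]|->] := tri_classP x; last first.
  by rewrite inE => /eqP->; exact: connect0.
rewrite (tri_class_tri tA xA) => yA; have [z zA zP] := tri_bypass tA xA xC.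
have toz w : w \in A -> connect (adj lift) w z.
  move=> wA; have [->|wz] := eqVneq w z; first exact: connect0.
  have /card_gt0P[e] : 0 < n_inner [set w; z] by rewrite (tri_pair tA).
  rewrite !inE /= => se.
  have Ee : ends e = [set w; z] by apply/eqP; rewrite eqEcard se card_endsE cards2 wz.
  have we : w \in ends e by rewrite Ee !inE eqxx.
  have ze : z \in ends e by rewrite Ee !inE eqxx orbT.
  have wC : tri_proj w \in verts C by move/subsetP: (tri_side tA xA xC) => /(_ w wA); rewrite inE.
  apply: (edge_connect _ we ze); rewrite in_setU (lift_sidesP tA wA wC zA zP we) ze andbT Ee.
  by apply/orP; right; apply/subsetP=> t /set2P[]->.
by apply: connect_trans (toz x xA) _; rewrite connect_adj_sym; exact: toz.
Qed.

Lemma lift_connected : connected lift.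
Proof.
have /andP[/andP[/set0Pn[c cV] /forall_inP conC] _] := cC.
apply/andP; split.
  by have [v Ev] := tri_proj_surj c; apply/set0Pn; exists v; rewrite inE -Ev.
apply/forall_inP=> x; rewrite inE => xC; apply/forall_inP=> y; rewrite inE => yC.
have /forall_inP/(_ _ yC) := conC _ xC.
suff h : forall d, connect (adj C) (tri_proj x) d ->
    forall w, tri_proj w = d -> connect (adj lift) x w by move/h; apply.
move=> d; apply: (connect_inv (P := fun d => forall w, tri_proj w = d -> connect (adj lift) x w)).
  move=> a b xa ab w wb; have [_ bC] := adj_verts ab.
  case/adjP: ab => e eC Ee.
  have : a \in ends e by rewrite Ee !inE eqxx.
  case/imsetP=> u ue au; have : b \in ends e by rewrite Ee !inE eqxx orbT.
  case/imsetP=> t te bt; apply: connect_trans (xa u (esym au)) _.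
  apply: (@connect_trans _ _ t); last by apply: lift_fiber; rewrite ?wb -bt.
  by apply: edge_connect ue te; rewrite in_setU imset_f.
by move=> w wx; exact: lift_fiber.
Qed.

(** A matching edge joins different classes, so it survives in the quotient and is dominated there;
    the lift contains the whole class of each vertex of [C]. *)
Lemma lift_dominates : dominates C [set: edge tri_quot] -> dominates lift M.
Proof.
move=> domC e eM; have [x [y [xy E]]] := endsP e.
have [xe ye] : (x \in ends e) /\ (y \in ends e) by rewrite E !inE !eqxx orbT.
have Ex : e = mu x by apply/eqP; rewrite -muE eM xe.
have c2 : #|tri_proj @: ends e| == 2.
  rewrite E imsetU1 imset_set1 cards2; have [|//] := eqVneq (tri_proj x) (tri_proj y).
  move/eqP; rewrite tri_proj_eq.
  have [[A [tA xA]]|->] := tri_classP x; last by rewrite inE eq_sym (negPf xy).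
  rewrite (tri_class_tri tA xA) => yA; have := tri_out tA xA.
  by move: ye; rewrite Ex ends_mu => /set2P[] Ey; [rewrite Ey eqxx in xy|rewrite -Ey yA].
have [|c ce cV] := domC (exist _ e c2); first by rewrite inE.
by case/imsetP: ce => v ve Ec; exists v; rewrite // inE -Ec.
Qed.

Lemma lift_cycle : is_cycle lift.
Proof.
apply/andP; split; first exact: lift_connected.
by apply/forall_inP=> v; rewrite inE => vC; rewrite lift_degree.
Qed.

End Lift.

Lemma tri_quot_nonempty : 0 < #|vertex tri_quot|.
Proof.
have /card_gt0P[v _] : 0 < #|vertex G| by have := card_vertex_ge10; lia.
by apply/card_gt0P; exists (tri_proj v).
Qed.

End Contraction.

Theorem corollary2p9 :
  (forall (G : mgraph) (M : {set edge G}),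
     cubic G -> perfect_matching M -> k_connected 4 (contract M) ->
     exists C : subgraph G, is_cycle C /\ dominates C M)
  <->
  (forall G : mgraph, cyclically_4_edge_connected G ->
     exists C : subgraph G, dominating_cycle C).
Proof.
split=> [|dcc G M cG pM k4]; first exact: matching_to_dominating.
have cQ : cubic (tri_quot pM) by exact: tri_quot_cubic.
have e4 : essentially_4 (tri_quot pM) by exact: tri_quot_essentially_4.
have [C [cC domC]] : exists C : subgraph (tri_quot pM), dominating_cycle C.
  (* Without two disjoint cycles [is_lambda_c] holds for no number, and [dcc] does not apply. *)
  have [cyc|no2] := classic (two_disjoint_cycles (tri_quot pM)).
    exact/dcc/essentially_4_c4ec.
  by apply: small_dominating => //; exact: tri_quot_nonempty.
by exists (lift C); split; [exact: lift_cycle|exact: lift_dominates].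
Qed.
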